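(* Let $\mathcal{B}$ be a finite normal $\sqrt{\mathfrak{gl}_n}$-crystal. Then $$\mathsf{ch}(\mathcal{B})=\sum_{b\in\mathsf{HW}(\mathcal{B})} G_{\mathrm{wt}(b)}(x_1,x_2,\dots,x_n),$$ where, for each $b\in\mathsf{HW}(\mathcal{B})$, $\mathrm{wt}(b)$ is a partition with at most $n$ parts.
   Context: Fix a positive integer $n$; $[n]=\{1,\dots,n\}$ and $\mathbf{e}_1,\dots,\mathbf{e}_n$ is the standard basis of $\mathbb{Z}^n$. A $\sqrt{\mathfrak{gl}_n}$-crystal is a set $\mathcal{B}$ with maps $\mathrm{wt}:\mathcal{B}\to\mathbb{Z}^n$ and $e_i,f_i:\mathcal{B}\to\mathcal{B}\sqcup\{0\}$ for $i\in[n-1]$ (with $0\notin\mathcal{B}$, and $e_i(0)=f_i(0)=0$) such that, setting $\varepsilon_i(b)=\sup\{k\ge0:e_i^k(b)\ne0\}$ and $\varphi_i(b)=\sup\{k\ge0:f_i^k(b)\ne0\}$, for all $i$ and $b,c\in\mathcal{B}$: (a) $\varepsilon_i(b),\varphi_i(b)$ are finite and $\frac{\varphi_i(b)-\varepsilon_i(b)}{2}=\mathrm{wt}(b)_i-\mathrm{wt}(b)_{i+1}$; (b) $e_i(b)=c$ iff $f_i(c)=b$, in which case $\mathrm{wt}(c)-\mathrm{wt}(b)=\mathbf{e}_i$ if $\varepsilon_i(b)$ is even and $=-\mathbf{e}_{i+1}$ if $\varepsilon_i(b)$ is odd. The crystal graph has an edge $b\xrightarrow{i}c$ when $f_i(b)=c\ne0$;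 a full subcrystal is the vertex set of a weakly connected component of this graph, with the restricted structure; an isomorphism is a weight-preserving bijection commuting with all $e_i,f_i$. An element $b$ is highest weight if $e_i(b)=0$ for all $i$; $\mathsf{HW}(\mathcal{B})$ is the set of these. The tensor product $\mathcal{B}\otimes\mathcal{C}$ of two such crystals is the set of symbols $b\otimes c$ with $\mathrm{wt}(b\otimes c)=\mathrm{wt}(b)+\mathrm{wt}(c)$, $e_i(b\otimes c)=b\otimes e_i(c)$ if $\varepsilon_i(b)\le\varphi_i(c)$ and $=e_i(b)\otimes c$ otherwise, $f_i(b\otimes c)=b\otimes f_i(c)$ if $\varepsilon_i(b)<\varphi_i(c)$ and $=f_i(b)\otimes c$ otherwise, with $b\otimes0=0\otimes c=0$ (this is associative). The trivial crystal $\mathbb{1}_n=\{\emptyset\}$ has one element of weight $0$ with all $e_i,f_i$ zero. The standard crystal $\mathsf{SS}_n$ is the set of nonempty subsets $S\subseteq[n]$ with $\mathrm{wt}(S)=\sum_{j\in S}\mathbf{e}_j$; $e_i(S)=S\cup\{i\}$ if $S\cap\{i,i+1\}=\{i+1\}$, $e_i(S)=S\setminus\{i+1\}$ if $S\cap\{i,i+1\}=\{i,i+1\}$, $e_i(S)=0$ otherwise; $f_i(S)=S\cup\{i+1\}$ if $S\cap\{i,i+1\}=\{i\}$, $f_i(S)=S\setminus\{i\}$ if $S\cap\{i,i+1\}=\{i,i+1\}$, $f_i(S)=0$ otherwise. A $\sqrt{\mathfrak{gl}_n}$-crystal is normal if each full subcrystal is isomorphic to a full subcrystal of $\mathsf{SS}_n^{\otimes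 m}$ for some $m\ge0$ (with $\mathsf{SS}_n^{\otimes0}=\mathbb{1}_n$). For finite $\mathcal{B}$, $\mathsf{ch}(\mathcal{B})=\sum_{b\in\mathcal{B}}x^{\mathrm{wt}(b)}$ where $x^{\alpha}=x_1^{\alpha_1}\cdots x_n^{\alpha_n}$. For a partition $\lambda$ with at most $n$ parts, with Young diagram $\{(i,j):1\le j\le\lambda_i\}$ (matrix coordinates), a semistandard set-valued tableau of shape $\lambda$ fills each box with a nonempty subset of $[n]$ such that every choice of one element from each box gives weakly increasing rows and strictly increasing columns; its weight is $\sum_{\text{boxes}}\sum_{k\in\text{entry}}\mathbf{e}_k$. The symmetric Grothendieck polynomial $G_\lambda(x_1,\dots,x_n)$ is the sum of $x^{\mathrm{wt}(T)}$ over all such tableaux $T$. *)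

(* Defs.v *)
From mathcomp Require Import all_boot all_order all_algebra.
From mathcomp Require Import mpoly.

Set Implicit Arguments.
Unset Strict Implicit.
Unset Printing Implicit Defensive.

Import GRing.Theory.
Local Open Scope ring_scope.

(* [n] is 'I_n and [n-1] is 'I_n.-1, both counted from 0: lo i and hi i are  *)
(* the elements i and i+1 of [n] attached to an index i of [n-1].            *)
Lemma lo_subproof n (i : 'I_n.-1) : (i < n)%N.
Proof. exact: leq_trans (ltn_ord i) (leq_pred n). Qed.

Lemma hi_subproof n (i : 'I_n.-1) : (i.+1 < n)%N.
Proof. by case: n i => [|n] [i]. Qed.

Definition lo n (i : 'I_n.-1) : 'I_n := Ordinal (lo_subproof i).
Definition hi n (i : 'I_n.-1) : 'I_n := Ordinal (hi_subproof i).

Definition unit_vec n (j : 'I_n) : 'rV[int]_n := delta_mx 0 j.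

(* The data of a crystal, without its axioms; None is the element 0.         *)
Record precrystal (n : nat) := Precrystal {
  vertex :> finType;
  wt : vertex -> 'rV[int]_n;
  e : 'I_n.-1 -> vertex -> option vertex;
  f : 'I_n.-1 -> vertex -> option vertex
}.

Definition iter_op (T : Type) (g : T -> option T) (k : nat) (b : T) : option T :=
  iter k (obind g) (Some b).

Definition finite_string (T : finType) (g : T -> option T) (b : T) : Prop :=
  exists N : nat, forall k : nat, iter_op g k b != None -> (k <= N)%N.

(* sup {k | g^k b <> 0} when this is finite: g^k b <> 0 with k >= #|T| would *)
(* force a repetition among b, g b, ..., g^k b, hence an infinite string.    *)
Definition string_length (T : finType) (g : T -> option T) (b : T) : nat :=
  \max_(k < #|T| | iter_op g k b != None) k.

Definition eps n (B : precrystal n) (i : 'I_n.-1) (b : B) : nat :=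
  string_length (e i) b.
Definition phi n (B : precrystal n) (i : 'I_n.-1) (b : B) : nat :=
  string_length (f i) b.

Definition is_crystal n (B : precrystal n) : Prop :=
  forall i : 'I_n.-1,
    [/\ forall b : B,
          [/\ finite_string (e i) b, finite_string (f i) b &
              ((phi i b)%:R - (eps i b)%:R) / 2%:R
                = (wt b 0 (lo i) - wt b 0 (hi i))%:~R :> rat],
        forall b c : B, e i b = Some c <-> f i c = Some b &
        forall b c : B, e i b = Some c ->
          wt c - wt b = if odd (eps i b) then - unit_vec (hi i)
                        else unit_vec (lo i)].

Definition edge n (B : precrystal n) : rel B :=
  fun b c => [exists i : 'I_n.-1, f i b == Some c].

Definition weakly_connected n (B : precrystal n) : rel B :=
  connect (fun b c => edge b c || edge c b).

Definition subcrystal n (B : precrystal n) (P : pred B) : precrystal n :=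
  @Precrystal n {b : B | P b}
    (fun b => wt (val b))
    (fun i b => obind insub (e i (val b)))
    (fun i b => obind insub (f i (val b))).

Definition full_subcrystal n (B : precrystal n) (b : B) : precrystal n :=
  subcrystal (weakly_connected b).

Definition isomorphic n (B C : precrystal n) : Prop :=
  exists g : B -> C,
    [/\ bijective g,
        forall b : B, wt (g b) = wt b,
        forall i (b : B), e i (g b) = omap g (e i b) &
        forall i (b : B), f i (g b) = omap g (f i b)].

Definition tensor n (B C : precrystal n) : precrystal n :=
  @Precrystal n (B * C)%type
    (fun x => wt x.1 + wt x.2)
    (fun i x => if (eps i x.1 <= phi i x.2)%N
                then omap (fun c => (x.1, c)) (e i x.2)
                else omap (fun b => (b, x.2)) (e i x.1))
    (fun i x => if (eps i x.1 < phi i x.2)%N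
                then omap (fun c => (x.1, c)) (f i x.2)
                else omap (fun b => (b, x.2)) (f i x.1)).

Definition trivial_crystal n : precrystal n :=
  @Precrystal n unit (fun _ => 0) (fun _ _ => None) (fun _ _ => None).

Definition SS_vertex n : finType := {S : {set 'I_n} | S != set0}.

(* insub only repackages a set as a nonempty one: it never returns None in   *)
(* the two operators below.                                                  *)
Definition SS_e n (i : 'I_n.-1) (S : SS_vertex n) : option (SS_vertex n) :=
  let J := val S :&: [set lo i; hi i] in
  if J == [set hi i] then insub (lo i |: val S)
  else if J == [set lo i; hi i] then insub (val S :\ hi i)
  else None.

Definition SS_f n (i : 'I_n.-1) (S : SS_vertex n) : option (SS_vertex n) :=
  let J := val S :&: [set lo i; hi i] in
  if J == [set lo i] then insub (hi i |: val S)
  else if J == [set lo i; hi i] then insub (val S :\ lo i)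
  else None.

Definition SS n : precrystal n :=
  @Precrystal n (SS_vertex n) (fun S => \sum_(j in val S) unit_vec j)
    (@SS_e n) (@SS_f n).

(* The trivial crystal is a unit for the tensor product, so that the first   *)
(* power is SS n up to isomorphism.                                          *)
Fixpoint SS_power n (m : nat) : precrystal n :=
  if m is m'.+1 then tensor (SS n) (SS_power n m') else trivial_crystal n.

Definition normal_crystal n (B : precrystal n) : Prop :=
  is_crystal B /\
  forall b : B, exists (m : nat) (c : SS_power n m),
    isomorphic (full_subcrystal b) (full_subcrystal c).

Definition HW n (B : precrystal n) : {set B} :=
  [set b : B | [forall i : 'I_n.-1, e i b == None]].

(* Weights may be negative: Laurent polynomials are taken inside the field   *)
(* of rational functions.                                                    *)
Definition ratfun (n : nat) : fieldType := {fraction {mpoly int[n]}}.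

Definition xpow n (a : 'rV[int]_n) : ratfun n :=
  \prod_(j < n) (tofrac ('X_j : {mpoly int[n]}) : ratfun n) ^ (a 0 j).

Definition ch n (B : precrystal n) : ratfun n := \sum_(b : B) xpow (wt b).

Definition is_partition n (a : 'rV[int]_n) : Prop :=
  (forall i : 'I_n, 0 <= a 0 i) /\
  (forall i j : 'I_n, (i <= j)%N -> a 0 j <= a 0 i).

(* The parts of a; meaningful only when is_partition a.                      *)
Definition parts n (a : 'rV[int]_n) : 'I_n -> nat := fun i => absz (a 0 i).

Definition box n (lam : 'I_n -> nat) : finType := {i : 'I_n & 'I_(lam i)}.
Definition box_row n (lam : 'I_n -> nat) (u : box lam) : nat := tag u.
Definition box_col n (lam : 'I_n -> nat) (u : box lam) : nat := tagged u.

Definition semistandard n (lam : 'I_n -> nat) (t : {ffun box lam -> 'I_n}) : bool :=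
  [forall u, forall v,
     ((box_row u == box_row v) && (box_col u < box_col v)%N ==> (t u <= t v)%N)
  && ((box_col u == box_col v) && (box_row u < box_row v)%N ==> (t u < t v)%N)].

Definition set_valued_semistandard n (lam : 'I_n -> nat)
    (T : {ffun box lam -> {set 'I_n}}) : bool :=
  [forall u, T u != set0] &&
  [forall t : {ffun box lam -> 'I_n},
     [forall u, t u \in T u] ==> semistandard t].

Definition tableau_wt n (lam : 'I_n -> nat)
    (T : {ffun box lam -> {set 'I_n}}) : 'rV[int]_n :=
  \sum_(u : box lam) \sum_(k in T u) unit_vec k.

Definition Grothendieck n (lam : 'I_n -> nat) : ratfun n :=
  \sum_(T : {ffun box lam -> {set 'I_n}} | set_valued_semistandard T)
     xpow (tableau_wt T).

(* Main.v *)
Require Import Defs.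
From mathcomp Require Import all_boot all_order all_algebra.
From mathcomp Require Import fingroup perm mpoly.
From mathcomp Require Import zify ring.

Set Implicit Arguments.
Unset Strict Implicit.
Unset Printing Implicit Defensive.

Import Order.TTheory GRing.Theory Num.Theory.
Local Open Scope ring_scope.

(* Let J be the alternating sum over S_n and g = x^rho prod_j (1 + x_j)^(j-1).
   Reversing i-strings shows that the character of a normal crystal is
   symmetric, so that ch(B) J(g) is the sum of the J(x^wt(b) g). If S is an
   i-string with its top removed, then the sum of x^wt(b) g over b in S is
   fixed by exchanging x_i and x_(i+1), hence is killed by J. In tensor powers
   of the standard crystal the non-highest weight elements are partitioned into
   such truncated strings: if b = u (x) S (x) w, where w is the longest highest
   weight suffix, use the largest i such that e_i does not kill S (x) w. Thus
   ch(Y) J(g) is the sum of J(x^wt(b) g) over the highest weight b in Y, for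
   every Y stable under the crystal operators. Reading set-valued tableaux of
   shape lambda by columns gives such a Y whose only highest weight element has
   weight lambda, so that G_lambda J(g) = J(x^lambda g); and J(g) is a nonzero
   Vandermonde determinant in the 1 + 1/x_k. *)

(** * Regular crystals and tensor products *)

(** The recursion makes [iter_op g k b] nonzero exactly for [k <= L b]. All values up to [L b] occur
    along the string, so [L b < #|T|] and the cutoff in [string_length] loses nothing. *)
Lemma string_lengthE (T : finType) (g : T -> option T) (L : T -> nat) :
  (forall b, L b = if g b is Some c then (L c).+1 else 0%N) ->
  forall b, string_length g b = L b.
Proof.
move=> Lrec.
have iterE k b : (iter_op g k b != None) = (k <= L b)%N.
  elim: k b => [|k IHk] b; first by rewrite leq0n.
  rewrite /iter_op iterSr /= Lrec; case: (g b) => [c|].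
    by rewrite ltnS -IHk.
  have -> : iter k (obind g) None = None by elim: k {IHk} => //= k ->.
  by [].
have hits k b : (k <= L b)%N -> exists c, L c = k.
  move Lb: (L b) => l; elim: l b Lb => [|l IHl] b Lb.
    by rewrite leqn0 => /eqP->; exists b.
  rewrite leq_eqVlt => /predU1P[->|]; first by exists b.
  move: (Lb); rewrite Lrec; case: (g b) => // c [Lc]; rewrite ltnS.
  exact: IHl Lc.
have lt_card b : (L b < #|T|)%N.
  have /fin_all_exists [h Lh] : forall k : 'I_(L b).+1, exists c, L c = k.
    by move=> k; apply: (hits _ b); rewrite -ltnS.
  rewrite -[(L b).+1]card_ord -(card_codom (f := h)) ?max_card //.
  by move=> k l hkl; apply: val_inj; rewrite /= -!Lh hkl.
move=> b; rewrite /string_length; apply/eqP; rewrite eqn_leq; apply/andP; split.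
  by apply/bigmax_leqP => k; rewrite iterE.
by rewrite (leq_bigmax_cond (Ordinal (lt_card b))) // iterE.
Qed.

(* The consequences of the crystal axioms that pass to tensor products without
   reference to the finiteness of strings. *)
Definition regular n (B : precrystal n) : Prop :=
  forall i : 'I_n.-1,
    [/\ forall b c : B, e i b = Some c <-> f i c = Some b,
        forall b : B, eps i b = if e i b is Some c then (eps i c).+1 else 0%N,
        forall b : B, phi i b = if f i b is Some c then (phi i c).+1 else 0%N,
        forall b : B, (phi i b)%:Z - (eps i b)%:Z
                        = (wt b 0 (lo i) - wt b 0 (hi i)) *+ 2 &
        forall b c : B, e i b = Some c ->
          wt c = wt b + if odd (eps i b) then - unit_vec (hi i)
                        else unit_vec (lo i)].

Section Regular.
Variables (n : nat) (B : precrystal n).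
Hypothesis regB : regular B.
Implicit Types (i : 'I_n.-1) (b c : B).

Lemma e_f i b c : e i b = Some c <-> f i c = Some b.
Proof. by case: (regB i). Qed.

Lemma eps_e i b c : e i b = Some c -> eps i b = (eps i c).+1.
Proof. by move=> eb; case: (regB i) => _ -> _ _ _; rewrite eb. Qed.

Lemma phi_f i b c : f i b = Some c -> phi i b = (phi i c).+1.
Proof. by move=> fb; case: (regB i) => _ _ -> _ _; rewrite fb. Qed.

Lemma phi_e i b c : e i b = Some c -> phi i c = (phi i b).+1.
Proof. by move/e_f/phi_f. Qed.

Lemma eps_f i b c : f i b = Some c -> eps i c = (eps i b).+1.
Proof. by move/e_f/eps_e. Qed.

Lemma eps_eq0 i b : (eps i b == 0%N) = (e i b == None).
Proof. by case: (regB i) => _ -> _ _ _; case: (e i b). Qed.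

Lemma phi_eq0 i b : (phi i b == 0%N) = (f i b == None).
Proof. by case: (regB i) => _ _ -> _ _; case: (f i b). Qed.

Lemma phi_sub_eps i b :
  (phi i b)%:Z - (eps i b)%:Z = (wt b 0 (lo i) - wt b 0 (hi i)) *+ 2.
Proof. by case: (regB i). Qed.

Lemma odd_eps_phi i b : odd (eps i b) = odd (phi i b).
Proof. have := phi_sub_eps i b; lia. Qed.

Lemma wt_e i b c : e i b = Some c ->
  wt c = wt b + if odd (eps i b) then - unit_vec (hi i) else unit_vec (lo i).
Proof. by case: (regB i) => _ _ _ _; apply. Qed.

End Regular.

Section Tensor.
Variables (n : nat) (B C : precrystal n).
Hypotheses (regB : regular B) (regC : regular C).

(** [e i] first acts on [x.1], until its [eps] has dropped to [phi i x.2], and from then on only on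
    [x.2], whose [phi] grows. *)
Lemma eps_tensor i (x : tensor B C) :
  eps i x = (eps i x.2 + (eps i x.1 - phi i x.2))%N.
Proof.
apply: (string_lengthE (L := fun x : tensor B C =>
  (eps i x.2 + (eps i x.1 - phi i x.2))%N)) => -[b c] /=.
case: leqP => [le_bc|lt_cb].
  case ec: (e i c) => [c'|] /=.
    by have := eps_e regC ec; have := phi_e regC ec; lia.
  by move/eqP: ec; rewrite -(eps_eq0 regC); lia.
case eb: (e i b) => [b'|] /=; first by have := eps_e regB eb; lia.
by move/eqP: eb; rewrite -(eps_eq0 regB); lia.
Qed.

(** [f i] first acts on [x.2], until its [phi] has dropped to [eps i x.1], and from then on only on
    [x.1], whose [eps] grows. *)
Lemma phi_tensor i (x : tensor B C) :
  phi i x = (phi i x.1 + (phi i x.2 - eps i x.1))%N.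
Proof.
apply: (string_lengthE (L := fun x : tensor B C =>
  (phi i x.1 + (phi i x.2 - eps i x.1))%N)) => -[b c] /=.
case: ltnP => [lt_bc|le_cb].
  case fc: (f i c) => [c'|] /=; first by have := phi_f regC fc; lia.
  by move/eqP: fc; rewrite -(phi_eq0 regC); lia.
case fb: (f i b) => [b'|] /=.
  by have := phi_f regB fb; have := eps_f regB fb; lia.
by move/eqP: fb; rewrite -(phi_eq0 regB); lia.
Qed.

Lemma regular_tensor : regular (tensor B C).
Proof.
move=> i; split.
- move=> [b c] [b' c'] /=; split.
    case: (leqP (eps i b) (phi i c)) => [le_bc|lt_cb].
      case ec: (e i c) => [c1|] //= [<- <-].
      have := phi_e regC ec; move/(e_f regC): (ec) => -> phic.
      by rewrite ifT //; lia.
    case eb: (e i b) => [b1|] //= [<- <-].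
    have := eps_e regB eb; move/(e_f regB): (eb) => -> epsb.
    by rewrite ifF //; lia.
  case: (ltnP (eps i b') (phi i c')) => [lt_bc|le_cb].
    case fc: (f i c') => [c1|] //= [<- <-].
    have := phi_f regC fc; move/(e_f regC): (fc) => -> phic.
    by rewrite ifT //; lia.
  case fb: (f i b') => [b1|] //= [<- <-].
  have := eps_f regB fb; move/(e_f regB): (fb) => -> epsb.
  by rewrite ifF //; lia.
- move=> [b c]; rewrite [LHS]eps_tensor.
  case ebc: (e i _) => [x|]; last first.
    move: ebc => /=; case: leqP => [le_bc|lt_cb].
      by case ec: (e i c) => // _; move/eqP: ec; rewrite -(eps_eq0 regC); lia.
    by case eb: (e i b) => // _; move/eqP: eb; rewrite -(eps_eq0 regB); lia.
  rewrite eps_tensor; move: ebc => /=; case: leqP => [le_bc|lt_cb].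
    case ec: (e i c) => [c1|] //= [<-] /=.
    by have := phi_e regC ec; have := eps_e regC ec; lia.
  by case eb: (e i b) => [b1|] //= [<-] /=; have := eps_e regB eb; lia.
- move=> [b c]; rewrite [LHS]phi_tensor.
  case fbc: (f i _) => [x|]; last first.
    move: fbc => /=; case: ltnP => [lt_bc|le_cb].
      by case fc: (f i c) => // _; move/eqP: fc; rewrite -(phi_eq0 regC); lia.
    by case fb: (f i b) => // _; move/eqP: fb; rewrite -(phi_eq0 regB); lia.
  rewrite phi_tensor; move: fbc => /=; case: ltnP => [lt_bc|le_cb].
    by case fc: (f i c) => [c1|] //= [<-] /=; have := phi_f regC fc; lia.
  case fb: (f i b) => [b1|] //= [<-] /=.
  by have := phi_f regB fb; have := eps_f regB fb; lia.
- move=> [b c]; rewrite eps_tensor phi_tensor /= !mxE.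
  have := phi_sub_eps regB i b; have := phi_sub_eps regC i c.
  move: (wt b 0 _) (wt c 0 _) (wt b 0 _) (wt c 0 _) => x y z t; lia.
move=> [b c] [b' c']; rewrite eps_tensor /=; case: leqP => [le_bc|lt_cb].
  case ec: (e i c) => [c1|] //= [<- <-].
  by rewrite (wt_e regC ec) addrA (_ : _ + _ = eps i c)%N //; lia.
case eb: (e i b) => [b1|] //= [<- <-].
(* Here [eps] of the pair is [eps i c + eps i b - phi i c], which has the parity of [eps i b]
   because [eps i c] and [phi i c] have equal parity. *)
rewrite (wt_e regB eb) addrAC (_ : odd (_ + _)%N = odd (eps i b)) //.
by have := odd_eps_phi regC i c; lia.
Qed.

End Tensor.

Lemma string_length0 (T : finType) (g : T -> option T) b :
  (forall b, g b = None) -> string_length g b = 0%N.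
Proof.
by move=> g0; apply: (string_lengthE (L := fun=> 0%N)) => c; rewrite g0.
Qed.

Lemma regular_trivial n : regular (trivial_crystal n).
Proof.
move=> i; split=> // b; rewrite /eps /phi ?string_length0 //.
by rewrite !mxE.
Qed.

Lemma lo_neq_hi n (i : 'I_n.-1) : lo i != hi i.
Proof. by rewrite -val_eqE /= neq_ltn ltnSn. Qed.

(** * The standard crystal and its tensor powers *)

Section SubsetCrystal.
Variable n : nat.
Implicit Types (i : 'I_n.-1) (S : SS n).

Lemma SS_eE i S :
  e i S = if hi i \in val S
          then insub (if lo i \in val S then val S :\ hi i else lo i |: val S)
          else None.
Proof.
have lohi := lo_neq_hi i.
rewrite /= /SS_e.
have -> : (val S :&: [set lo i; hi i] == [set hi i]) =
    (hi i \in val S) && (lo i \notin val S).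
  apply/eqP/andP => [/setP eqS|[hS lS]].
    have := eqS (hi i); have := eqS (lo i); rewrite !inE !eqxx (negPf lohi).
    by rewrite orbT !andbT => -> ->.
  apply/setP => j; rewrite !inE; case: (eqVneq j (hi i)) => [->|_].
    by rewrite hS orbT.
  by case: eqVneq => [->|_]; rewrite ?(negPf lS) ?andbF.
have -> : (val S :&: [set lo i; hi i] == [set lo i; hi i]) =
    (hi i \in val S) && (lo i \in val S).
  apply/eqP/andP => [/setP eqS|[hS lS]].
    have := eqS (hi i); have := eqS (lo i); rewrite !inE !eqxx.
    by rewrite orbT !andbT => -> ->.
  apply/setP => j; rewrite !inE; case: (eqVneq j (hi i)) => [->|_].
    by rewrite hS orbT.
  by case: eqVneq => [->|_]; rewrite ?lS ?andbF.
by case: (hi i \in _); case: (lo i \in _).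
Qed.

Lemma SS_fE i S :
  f i S = if lo i \in val S
          then insub (if hi i \in val S then val S :\ lo i else hi i |: val S)
          else None.
Proof.
have lohi := lo_neq_hi i; have hilo := lohi; rewrite eq_sym in hilo.
rewrite /= /SS_f.
have -> : (val S :&: [set lo i; hi i] == [set lo i]) =
    (lo i \in val S) && (hi i \notin val S).
  apply/eqP/andP => [/setP eqS|[hS lS]].
    have := eqS (hi i); have := eqS (lo i); rewrite !inE !eqxx (negPf hilo).
    by rewrite orbT !andbT => -> ->.
  apply/setP => j; rewrite !inE; case: (eqVneq j (lo i)) => [->|_].
    by rewrite hS.
  by case: eqVneq => [->|_]; rewrite ?(negPf lS) ?andbF.
have -> : (val S :&: [set lo i; hi i] == [set lo i; hi i]) =
    (lo i \in val S) && (hi i \in val S).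
  apply/eqP/andP => [/setP eqS|[hS lS]].
    have := eqS (hi i); have := eqS (lo i); rewrite !inE !eqxx.
    by rewrite orbT !andbT => -> ->.
  apply/setP => j; rewrite !inE; case: (eqVneq j (hi i)) => [->|_].
    by rewrite lS orbT.
  by case: eqVneq => [->|_]; rewrite ?hS ?andbF.
by case: (hi i \in _); case: (lo i \in _).
Qed.

Lemma SS_e_Some i S S' :
  e i S = Some S' <->
  hi i \in val S /\
  val S' = (if lo i \in val S then val S :\ hi i else lo i |: val S).
Proof.
rewrite SS_eE; case: ifP => [hS|_]; last by split=> // -[].
split=> [|[_ S'E]].
  by case: insubP => // S1 _ S1E [<-].
rewrite -S'E insubT //; last by move=> S'0; congr Some; apply: val_inj.
by case: S' {S'E}.
Qed.

Lemma SS_f_Some i S S' :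
  f i S = Some S' <->
  lo i \in val S /\
  val S' = (if hi i \in val S then val S :\ lo i else hi i |: val S).
Proof.
rewrite SS_fE; case: ifP => [hS|_]; last by split=> // -[].
split=> [|[_ S'E]].
  by case: insubP => // S1 _ S1E [<-].
rewrite -S'E insubT //; last by move=> S'0; congr Some; apply: val_inj.
by case: S' {S'E}.
Qed.

Lemma SS_e_total i S : hi i \in val S -> exists S', e i S = Some S'.
Proof.
move=> hS; rewrite SS_eE hS.
case: insubP => [S' _ _|]; first by exists S'.
rewrite negbK => /eqP/setP; case: ifP => lS.
  by move/(_ (lo i)); rewrite !inE lS (negPf (lo_neq_hi i)).
by move/(_ (lo i)); rewrite !inE eqxx.
Qed.

Lemma SS_f_total i S : lo i \in val S -> exists S', f i S = Some S'.
Proof.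
move=> lS; rewrite SS_fE lS.
case: insubP => [S' _ _|]; first by exists S'.
rewrite negbK => /eqP/setP; case: ifP => hS.
  by move/(_ (hi i)); rewrite !inE hS eq_sym (negPf (lo_neq_hi i)).
by move/(_ (hi i)); rewrite !inE eqxx.
Qed.

(** The [i]-strings of [SS n] are single points or chains of three sets, which meet [{lo i, hi i}]
    in [{lo i}], then in both, then in [{hi i}]. *)
Lemma SS_epsE i S :
  eps i S = if hi i \in val S then (if lo i \in val S then 1 else 2)%N else 0%N.
Proof.
apply: (string_lengthE (L := fun S : SS n =>
  if hi i \in val S then (if lo i \in val S then 1 else 2)%N else 0%N)).
move=> {}S; have lohi := lo_neq_hi i; have hilo := lohi; rewrite eq_sym in hilo.
case hS: (hi i \in val S); last by rewrite SS_eE hS.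
have [S' eS] := SS_e_total hS.
have /SS_e_Some[_ S'E] := eS; rewrite eS /= S'E.
by case: ifP => lS; rewrite !inE ?eqxx ?hS ?orbT.
Qed.

Lemma SS_phiE i S :
  phi i S = if lo i \in val S then (if hi i \in val S then 1 else 2)%N else 0%N.
Proof.
apply: (string_lengthE (L := fun S : SS n =>
  if lo i \in val S then (if hi i \in val S then 1 else 2)%N else 0%N)).
move=> {}S; have lohi := lo_neq_hi i; have hilo := lohi; rewrite eq_sym in hilo.
case lS: (lo i \in val S); last by rewrite SS_fE lS.
have [S' fS] := SS_f_total lS.
have /SS_f_Some[_ S'E] := fS; rewrite fS /= S'E.
by case: ifP => hS; rewrite !inE ?eqxx ?lS ?orbT.
Qed.

Lemma SS_wtE S j : wt S 0 j = (j \in val S)%:Z.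
Proof.
rewrite /= summxE.
under eq_bigr => k _ do rewrite /unit_vec mxE eqxx /=.
case jS: (j \in val S) => /=.
  rewrite (bigD1 j) //= eqxx big1 ?addr0 // => k /andP[_ kj].
  by rewrite eq_sym (negPf kj).
rewrite big1 // => k kS; case: eqVneq => // jk.
by rewrite jk kS in jS.
Qed.

Lemma regular_SS : regular (SS n).
Proof.
move=> i; have lohi := lo_neq_hi i; have hilo := lohi; rewrite eq_sym in hilo.
split.
- move=> S S'; split=> [/SS_e_Some|/SS_f_Some] [xS S'E].
    apply/SS_f_Some; rewrite S'E; case: ifP => lS; rewrite !inE ?eqxx ?lS ?xS.
      by rewrite lohi /= setD1K.
    by rewrite orbT; split=> //; rewrite setU1K // lS.
  apply/SS_e_Some; rewrite S'E; case: ifP => hS; rewrite !inE ?eqxx ?hS ?xS.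
    by rewrite hilo /= setD1K.
  by rewrite orbT; split=> //; rewrite setU1K // hS.
- move=> S; rewrite [LHS]SS_epsE; case hS: (hi i \in val S); last by rewrite SS_eE hS.
  have [S' eS] := SS_e_total hS.
  have /SS_e_Some[_ S'E] := eS; rewrite eS SS_epsE S'E.
  by case: ifP => lS; rewrite !inE ?eqxx ?hS ?orbT.
- move=> S; rewrite [LHS]SS_phiE; case lS: (lo i \in val S); last by rewrite SS_fE lS.
  have [S' fS] := SS_f_total lS.
  have /SS_f_Some[_ S'E] := fS; rewrite fS SS_phiE S'E.
  by case: ifP => hS; rewrite !inE ?eqxx ?lS ?orbT.
- move=> S; rewrite SS_epsE SS_phiE !SS_wtE.
  by case: ifP => lS; case: ifP.
move=> S S' /SS_e_Some[hS S'E]; apply/rowP => j.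
rewrite [in RHS]mxE !SS_wtE S'E SS_epsE hS.
case: ifP => lS /=; rewrite !mxE !inE eqxx /=.
  by case: eqVneq => [->|]; rewrite ?hS //= subr0.
by case: eqVneq => [->|]; rewrite ?lS //= addr0.
Qed.

End SubsetCrystal.

Lemma regular_SS_power n m : regular (SS_power n m).
Proof.
elim: m => [|m IHm]; first exact: regular_trivial.
exact: regular_tensor (@regular_SS n) IHm.
Qed.

(** This allows alternants of characters to be taken in the polynomial ring, without Laurent
    monomials. *)
Lemma SS_power_wt_ge0 n m (b : SS_power n m) j : 0 <= wt b 0 j.
Proof.
elim: m b => [|m IHm] b /=; first by rewrite mxE.
rewrite mxE; apply: addr_ge0; last exact: IHm.
by have := SS_wtE b.1 j => /= ->.
Qed.

(** * Strings and truncated strings *)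

Section Strings.
Variables (n : nat) (B : precrystal n).
Hypothesis regB : regular B.
Variable i : 'I_n.-1.
Implicit Types b c : B.

Definition string_top b : B := iter (eps i b) (fun c => odflt c (e i c)) b.

(** Positions count from the top, so [b] itself is at position [eps i b]; past the end the default
    repeats the bottom element. *)
Definition string_at k b : B :=
  iter k (fun c => odflt c (f i c)) (string_top b).

Lemma string_top_e b c : e i b = Some c -> string_top b = string_top c.
Proof. by move=> eb; rewrite /string_top (eps_e regB eb) iterSr eb. Qed.

Lemma string_top_f b c : f i b = Some c -> string_top c = string_top b.
Proof. by move/(e_f regB)/string_top_e. Qed.

Lemma eps_gt0 b : (0 < eps i b)%N -> exists c, e i b = Some c.
Proof.
by rewrite lt0n (eps_eq0 regB); case: (e i b) => // c _; exists c.
Qed.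

Lemma phi_gt0 b : (0 < phi i b)%N -> exists c, f i b = Some c.
Proof.
by rewrite lt0n (phi_eq0 regB); case: (f i b) => // c _; exists c.
Qed.

(** Going down a string, the weight alternately gains a unit at [hi i] and loses one at [lo i],
    beginning with the gain; hence the two halves of the position, rounded up and down. *)
Lemma string_topP b :
  [/\ eps i (string_top b) = 0%N,
      phi i (string_top b) = (eps i b + phi i b)%N,
      string_top (string_top b) = string_top b &
      forall j, wt b 0 j = wt (string_top b) 0 j
                  - ((j == lo i) * (eps i b)./2)%N%:Z
                  + ((j == hi i) * uphalf (eps i b))%N%:Z].
Proof.
move epsb: (eps i b) => k; elim: k b epsb => [|k IHk] b epsb.
  have topb : string_top b = b by rewrite /string_top epsb.
  by rewrite !topb epsb; split=> // j; rewrite !muln0 subr0 addr0.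
have [c ebc] : exists c, e i b = Some c by apply: eps_gt0; rewrite epsb.
have epsc : eps i c = k by have := eps_e regB ebc; rewrite epsb => -[].
rewrite (string_top_e ebc); have [-> -> IHtop IHwt] := IHk c epsc; split=> //.
  by rewrite (phi_e regB ebc) addnS.
move=> j; have wtc : wt c 0 j = wt b 0 j +
    (if odd k.+1 then - unit_vec (hi i) else unit_vec (lo i)) 0 j.
  by rewrite (wt_e regB ebc) mxE epsb.
move: wtc; rewrite IHwt /=.
case: ifP => [ok|/negbT ok]; rewrite !mxE /=;
  move: (wt b 0 j) (wt (string_top c) 0 j) => x y;
  case: (j == lo i); case: (j == hi i) => /=; lia.
Qed.

Lemma string_at_eps b : string_at (eps i b) b = b.
Proof.
move epsb: (eps i b) => k; elim: k b epsb => [|k IHk] b epsb.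
  by rewrite /string_at /string_top epsb.
have [c ebc] : exists c, e i b = Some c by apply: eps_gt0; rewrite epsb.
have epsc : eps i c = k by have := eps_e regB ebc; rewrite epsb => -[].
rewrite /string_at iterS (string_top_e ebc) -/(string_at k c) IHk //.
by move/(e_f regB): ebc => ->.
Qed.

Lemma string_atP k b : (k <= eps i b + phi i b)%N ->
  string_top (string_at k b) = string_top b /\ eps i (string_at k b) = k.
Proof.
have [eps0 phi0 top0 _] := string_topP b.
elim: k => [|k IHk] le_k; first by rewrite /string_at /= top0 eps0.
have [topk epsk] := IHk (ltnW le_k).
have [_ phik _ _] := string_topP (string_at k b).
have [c fc] : exists c, f i (string_at k b) = Some c.
  by apply: phi_gt0; move: phik; rewrite topk phi0 epsk; lia.
rewrite /string_at iterS -/(string_at k b) fc /=.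
by rewrite (string_top_f fc) (eps_f regB fc) epsk.
Qed.

Lemma string_inj b c :
  string_top b = string_top c -> eps i b = eps i c -> b = c.
Proof.
move=> top_bc eps_bc; rewrite -[b]string_at_eps -[c]string_at_eps eps_bc.
by rewrite /string_at top_bc.
Qed.

Lemma eps_phi_top b c : string_top b = string_top c ->
  (eps i b + phi i b = eps i c + phi i c)%N.
Proof.
move=> top_bc; have [_ <- _ _] := string_topP b.
by have [_ <- _ _] := string_topP c; rewrite top_bc.
Qed.

(** The threshold covers both kinds of sets: [t = 0] for unions of whole strings, [t = 1] for unions
    of strings with the top removed. *)
Lemma string_closed (Q : pred B) t :
  (forall b c, f i b = Some c -> Q b -> Q c) ->
  (forall b c, e i b = Some c -> (t <= eps i c)%N -> Q b -> Q c) ->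
  forall b c, string_top b = string_top c ->
    (t <= eps i c)%N -> Q b -> Q c.
Proof.
move=> Qf Qe b c top_bc tc.
have [le_cb|lt_bc] := leqP (eps i c) (eps i b).
  move eps_bc: (eps i b - eps i c)%N => d.
  elim: d b top_bc le_cb eps_bc => [|d IHd] b top_bc le_cb eps_bc Qb.
    by rewrite -(string_inj top_bc) //; lia.
  have [b' eb] : exists b', e i b = Some b' by apply: eps_gt0; lia.
  have epsb := eps_e regB eb.
  by apply: (IHd b'); [rewrite -(string_top_e eb)| lia| lia|
    apply: Qe eb _ Qb; lia].
move eps_bc: (eps i c - eps i b)%N => d.
elim: d b top_bc {lt_bc}(ltnW lt_bc) eps_bc => [|d IHd] b top_bc lt_bc eps_bc Qb.
  by rewrite -(string_inj top_bc) //; lia.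
have [b' fb] : exists b', f i b = Some b'.
  by apply: phi_gt0; have := eps_phi_top top_bc; lia.
have epsb := eps_f regB fb.
by apply: (IHd b'); [rewrite (string_top_f fb)| lia| lia| apply: Qf fb Qb].
Qed.

(* On the positions d.*2, ..., eps + phi of a string this is the reversal; it
   corresponds to exchanging the two exponents of x^wt x_lo^d. *)
Definition string_reflect d b : B := string_at (phi i b + d.*2)%N b.

Lemma string_reflectP d b : (d.*2 <= eps i b)%N ->
  [/\ string_top (string_reflect d b) = string_top b,
      eps i (string_reflect d b) = (phi i b + d.*2)%N &
      phi i (string_reflect d b) = (eps i b - d.*2)%N].
Proof.
move=> le_d; have [|top_r eps_r] := @string_atP (phi i b + d.*2) b; first lia.
split=> //; rewrite -/(string_reflect d b) in top_r eps_r.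
by have := eps_phi_top top_r; rewrite eps_r; lia.
Qed.

Lemma string_reflectK d b : (d.*2 <= eps i b)%N ->
  string_reflect d (string_reflect d b) = b.
Proof.
move=> le_d; have [top_r eps_r phi_r] := string_reflectP le_d.
have [|top_rr eps_rr phi_rr] := @string_reflectP d (string_reflect d b).
  by rewrite eps_r leq_addl.
by apply: string_inj; [rewrite top_rr | rewrite eps_rr phi_r subnK].
Qed.

(** By [phi_sub_eps] at the top, the length of the string is twice the difference of the two
    exponents there. So reflection preserves the parity of positions and trades their rounded-up
    halves for rounded-down ones, up to [d]. *)
Lemma wt_string_reflect d b j : (d.*2 <= eps i b)%N ->
  wt (string_reflect d b) 0 j + ((j == lo i) * d)%N%:Z
    = wt b 0 (tperm (lo i) (hi i) j)
        + ((tperm (lo i) (hi i) j == lo i) * d)%N%:Z.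
Proof.
move=> le_d; have [top_r eps_r phi_r] := string_reflectP le_d.
have [_ phi0 _ wtr] := string_topP (string_reflect d b).
have [eps0 _ _ wtb] := string_topP b.
have := phi_sub_eps regB i (string_top b).
have := odd_eps_phi regB i b.
rewrite wtr wtb top_r -top_r phi0 top_r eps0 eps_r phi_r.
have lohi := negPf (lo_neq_hi i); have hilo := lohi; rewrite eq_sym in hilo.
case: tpermP => [->|->|/eqP/negPf jlo /eqP/negPf jhi].
- rewrite !eqxx lohi hilo; move: (wt _ 0 _) (wt _ 0 _) => x y; lia.
- rewrite !eqxx lohi hilo; move: (wt _ 0 _) (wt _ 0 _) => x y; lia.
by rewrite jlo jhi /= !mul0n.
Qed.

End Strings.

(** * Truncated strings in tensor powers of the standard crystal *)

Section BadIndex.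
Variable n : nat.

Lemma HWP (B : precrystal n) (b : B) :
  reflect (forall i, e i b = None) (b \in HW B).
Proof. by rewrite inE; apply: 'forall_eqP. Qed.

Lemma HW_tensor (B C : precrystal n) (x : tensor B C) :
  regular B -> regular C ->
  reflect (x.2 \in HW C /\ forall i, (eps i x.1 <= phi i x.2)%N)
          (x \in HW (tensor B C)).
Proof.
case: x => b c regB regC.
apply: (iffP (@HWP (tensor B C) (b, c))) => [e0|[/HWP e0 le_bc] i].
  have le_bc i : (eps i b <= phi i c)%N.
    have := e0 i; rewrite /=; case: leqP => // lt_cb.
    case eb: (e i b) => // _; move/eqP: eb; rewrite -(eps_eq0 regB).
    by move=> /eqP eps0; rewrite eps0 in lt_cb.
  split=> //; apply/HWP => i; have := e0 i; rewrite /= le_bc.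
  by case: (e i c).
by rewrite /= le_bc e0.
Qed.

Lemma SS_power_rect m (P : SS_power n m.+1 -> Prop) :
  (forall (S : SS n) (w : SS_power n m), P (S, w)) -> forall x, P x.
Proof. by move=> PSw []. Qed.

Lemma SS_power_eE m (S : SS n) (w : SS_power n m) i :
  @e n (SS_power n m.+1) i (S, w)
    = if (eps i S <= phi i w)%N then omap (fun w' => (S, w')) (e i w)
      else omap (fun S' => (S', w)) (e i S).
Proof. by []. Qed.

Lemma SS_power_fE m (S : SS n) (w : SS_power n m) i :
  @f n (SS_power n m.+1) i (S, w)
    = if (eps i S < phi i w)%N then omap (fun w' => (S, w')) (f i w)
      else omap (fun S' => (S', w)) (f i S).
Proof. by []. Qed.

(** When [x.2] is of highest weight, these are exactly the [i] for which [e i] does not kill [x]. *)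
Definition violates m (x : SS_power n m.+1) : pred 'I_n.-1 :=
  fun i => (phi i x.2 < eps i x.1)%N.

(* Writing b = u (x) S (x) w with w the longest highest weight suffix, this is
   the largest i such that e_i does not kill S (x) w. The largest one is chosen
   because e_i and f_i only change whether i lies in S, which is irrelevant to
   the conditions of indices above i. *)
Fixpoint bad_index m : SS_power n m -> option 'I_n.-1 :=
  if m is m'.+1 then fun x =>
    if bad_index x.2 is Some i then Some i
    else [pick i | violates x i & [forall j : 'I_n.-1,
                                     (i < j)%N ==> ~~ violates x j]]
  else fun=> None.

Lemma bad_index_HW m (x : SS_power n m) : (bad_index x == None) = (x \in HW _).
Proof.
elim: m x => [|m IHm] x; first by apply/esym/HWP.
have regm := @regular_SS_power n m; have reg1 := @regular_SS n.
rewrite [LHS]/=; have := IHm x.2; case: (bad_index x.2) => [i|] /=.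
  move/esym/negbT => nHW; apply/esym/negbTE/negP.
  by move=> /(HW_tensor x reg1 regm)[HWx2 _]; rewrite HWx2 in nHW.
move/esym => HWx2; case: pickP => [i /andP[bad_i _]|no_bad].
  apply/esym/negbTE/negP => /(HW_tensor x reg1 regm)[_ /(_ i)].
  by rewrite leqNgt; apply/negP; rewrite negbK.
apply/esym/(HW_tensor x reg1 regm); split=> // i; rewrite leqNgt; apply/negP.
move=> bad_i; case: (@arg_maxnP _ i (violates x) (fun j => j : nat) bad_i).
move=> j bad_j max_j; have := no_bad j; rewrite bad_j /= => /negP; apply.
apply/forallP => k; apply/implyP => lt_jk; apply: contraL lt_jk => bad_k.
rewrite -leqNgt; exact: max_j.
Qed.

(** As [hi i] survives in [S'], the operator has only inserted [lo i], which is neither [lo j] nor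
    [hi j] when [j > i]. *)
Lemma violates_e m (S S' : SS n) (w : SS_power n m) (i j : 'I_n.-1) :
  e i S = Some S' -> hi i \in val S' -> (i < j)%N ->
  @violates m (S', w) j = @violates m (S, w) j.
Proof.
move=> /SS_e_Some[hS S'E] hS' lt_ij; rewrite /violates /=; congr (_ < _)%N.
have hj : hi j != hi i by rewrite -val_eqE /= eqSS neq_ltn lt_ij orbT.
have hlj : hi j != lo i by rewrite -val_eqE /= neq_ltn (ltn_trans lt_ij) ?orbT.
have lj : lo j != lo i by rewrite -val_eqE /= neq_ltn lt_ij orbT.
rewrite !SS_epsE; move: hS'; rewrite S'E; case: ifP => lS; first by rewrite !inE eqxx.
by rewrite !inE (negPf hlj) (negPf lj).
Qed.

Lemma bad_index_e m (x : SS_power n m) i :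
  bad_index x = Some i -> exists y, e i x = Some y.
Proof.
elim: m x => [|m IHm] //; elim/SS_power_rect => S w; rewrite SS_power_eE [bad_index _]/=.
have regm := @regular_SS_power n m; have reg1 := @regular_SS n.
case bw: (bad_index w) => [j|].
  move=> [ij]; rewrite {j}ij in bw; have [y ew] := IHm _ bw.
  case: leqP => [_|lt]; first by rewrite ew; eexists.
  have [|S' ->] := eps_gt0 reg1 (i := i) (b := S); first by lia.
  by eexists.
case: pickP => // j /andP[bad_j _] [ij]; rewrite {j}ij in bad_j.
have lt : (phi i w < eps i S)%N := bad_j.
rewrite leqNgt lt [~~ true]/=.
have [|S' ->] := eps_gt0 reg1 (i := i) (b := S); first by lia.
by eexists.
Qed.

Lemma bad_index_pick m (S : SS n) (w : SS_power n m) i :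
  w \in HW _ -> violates (S, w) i ->
  (forall j : 'I_n.-1, (i < j)%N -> ~~ violates (S, w) j) ->
  bad_index ((S, w) : SS_power n m.+1) = Some i.
Proof.
move=> HWw bad_i max_i /=.
move: (HWw); rewrite -bad_index_HW => /eqP->.
case: pickP => [j /andP[bad_j /forallP max_j]|/(_ i)]; last first.
  rewrite bad_i => /negP[]; apply/forallP => j; apply/implyP; exact: max_i.
congr Some; apply: val_inj; apply/eqP; rewrite eqn_leq; apply/andP; split.
  by rewrite leqNgt; apply/negP => /max_i; rewrite bad_j.
by rewrite leqNgt; apply/negP => lt_ji; have := max_j i; rewrite lt_ji bad_i.
Qed.

(** With [bad_index_e] and [bad_index_ee], this makes the elements of bad index [i] a union of
    [i]-strings without their tops. If the index comes from the current factor [S], then [f i] acts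
    on [S], raises its [eps], and does not affect larger indices by [violates_e]. *)
Lemma bad_index_f m (x y : SS_power n m) i :
  bad_index x = Some i -> f i x = Some y -> bad_index y = Some i.
Proof.
elim: m x y => [|m IHm] //; elim/SS_power_rect => S w.
elim/SS_power_rect => S' w' bx; rewrite SS_power_fE.
have regm := @regular_SS_power n m; have reg1 := @regular_SS n.
move: bx; rewrite [bad_index _]/=; case bw: (bad_index w) => [j|].
  move=> [ij]; rewrite {j}ij in bw.
  case: ltnP => _.
    case fw: (f i w) => [w1|] //= [_ <-].
    by rewrite (IHm _ _ bw fw).
  by case fS: (f i S) => [S1|] //= [_ <-]; rewrite bw.
case: pickP => // j /andP[bad_j /forallP max_j] [ij].
rewrite {j}ij in bad_j max_j.
have HWw : w \in HW _ by rewrite -bad_index_HW bw.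
have lt : (phi i w < eps i S)%N := bad_j.
rewrite ltnNge (ltnW lt); case fS: (f i S) => [S1|] //= [<- <-].
have eS1 : e i S1 = Some S by apply/(e_f reg1).
have hS : hi i \in val S.
  by move: lt; rewrite SS_epsE; case: (hi i \in val S).
apply: bad_index_pick => // [|j lt_ij].
  by change (phi i w < eps i S1)%N; rewrite (eps_f reg1 fS) ltnS ltnW.
by rewrite -(violates_e w eS1 hS lt_ij); have := max_j j; rewrite lt_ij.
Qed.

Lemma bad_index_ee m (x y : SS_power n m) i :
  bad_index x = Some i -> e i x = Some y -> (0 < eps i y)%N ->
  bad_index y = Some i.
Proof.
elim: m x y => [|m IHm] //; elim/SS_power_rect => S w.
elim/SS_power_rect => S' w' bx; rewrite SS_power_eE.
have regm := @regular_SS_power n m; have reg1 := @regular_SS n.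
rewrite (eps_tensor reg1 regm).
move: bx; rewrite [bad_index _]/=; case bw: (bad_index w) => [j|].
  move=> [ij]; rewrite {j}ij in bw.
  case: (leqP (eps i S) (phi i w)) => le.
    case ew: (e i w) => [w1|] //= [<- <-] gt0.
    rewrite (IHm _ _ bw ew) //.
    by have := phi_e regm ew; lia.
  by case eS: (e i S) => [S1|] //= [_ <-]; rewrite bw.
case: pickP => // j /andP[bad_j /forallP max_j] [ij].
rewrite {j}ij in bad_j max_j.
have HWw : w \in HW _ by rewrite -bad_index_HW bw.
have lt : (phi i w < eps i S)%N := bad_j.
rewrite [(eps i S <= phi i w)%N]leqNgt lt; case eS: (e i S) => [S1|] //= [<- <-].
(* The suffix [w] is of highest weight, so a nonzero [eps] of the result says that the new set still
   violates [i]. *)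
move/HWP/(_ i)/eqP: (HWw); rewrite -(eps_eq0 regm) => /eqP->; rewrite add0n => gt0.
have hS1 : hi i \in val S1.
  by move: gt0; rewrite SS_epsE; case: (hi i \in val S1).
apply: bad_index_pick => // [|j lt_ij].
  by change (phi i w < eps i S1)%N; rewrite -subn_gt0.
by rewrite (violates_e w eS hS1 lt_ij); have := max_j j; rewrite lt_ij.
Qed.

End BadIndex.

(** * Alternants and the character formula *)

Section Alternants.
Variable n : nat.
Implicit Types (p q : {mpoly int[n]}) (s : 'S_n) (i : 'I_n.-1).

Definition alternant p : {mpoly int[n]} :=
  \sum_(s : 'S_n) (-1) ^+ (s : bool) * msym s p.

Lemma alternant_sum (I : finType) (P : pred I) (F : I -> {mpoly int[n]}) :
  alternant (\sum_(k | P k) F k) = \sum_(k | P k) alternant (F k).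
Proof.
rewrite /alternant exchange_big /=; apply: eq_bigr => s _.
by rewrite raddf_sum mulr_sumr.
Qed.

Lemma alternant_sym p q :
  (forall s, msym s p = p) -> alternant (p * q) = p * alternant q.
Proof.
move=> symp; rewrite /alternant mulr_sumr; apply: eq_bigr => s _.
by rewrite msymM symp mulrCA.
Qed.

(** Pairing [s] with its product by the transposition shows that the alternant is its own opposite,
    and integer coefficients have no 2-torsion. *)
Lemma alternant_tperm (a b : 'I_n) p :
  a != b -> msym (tperm a b) p = p -> alternant p = 0.
Proof.
move=> ab symp; have altN : alternant p = - alternant p.
  rewrite {1}/alternant (reindex_inj (mulgI (tperm a b))) /= -sumrN.
  apply: eq_bigr => s _; rewrite odd_permM odd_tperm ab signr_addb expr1.
  by rewrite msymMm symp mulN1r mulNr.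
apply/mpolyP => m; rewrite mcoeff0.
by have := congr1 (mcoeff m) altN; rewrite mcoeffN; lia.
Qed.

Lemma msym_adjacent p :
  (forall i, msym (tperm (lo i) (hi i)) p = p) -> forall s, msym s p = p.
Proof.
move=> symp.
have symd d (a b : 'I_n) : (b = a + d.+1 :> nat)%N -> msym (tperm a b) p = p.
  elim: d a b => [|d IHd] a b ab.
    have lt_an : (a < n.-1)%N by have := ltn_ord b; lia.
    have -> : a = lo (Ordinal lt_an) by apply: val_inj.
    have -> : b = hi (Ordinal lt_an) by apply: val_inj; rewrite /= ab addn1.
    exact: symp.
  have lt_cn : (a + d.+1 < n)%N by have := ltn_ord b; lia.
  pose c := Ordinal lt_cn.
  have ac : msym (tperm a c) p = p by apply: IHd.
  have lt_cn1 : (c < n.-1)%N by have := ltn_ord b; rewrite /=; lia.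
  have cb : msym (tperm c b) p = p.
    have -> : c = lo (Ordinal lt_cn1) by apply: val_inj.
    have -> : b = hi (Ordinal lt_cn1) by apply: val_inj; rewrite /= ab addnS.
    exact: symp.
  (* Conjugation by the adjacent transposition of [c] and [b] lengthens the distance by one. *)
  have -> : tperm a b = (tperm a c ^ tperm c b)%g.
    by rewrite tpermJ tpermL tpermD //; rewrite -val_eqE /=; lia.
  by rewrite conjgE tpermV !msymMm cb ac cb.
have symt (a b : 'I_n) : msym (tperm a b) p = p.
  have [lt_ab|lt_ba|/val_inj->] := ltngtP a b; last by rewrite tperm1 msym1m.
    by apply: (symd (b - a.+1)%N); lia.
  by rewrite tpermC; apply: (symd (a - b.+1)%N); lia.
move=> s; have [ts -> _] := prod_tpermP s.
elim: ts => [|t ts IHts]; first by rewrite big_nil msym1m.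
by rewrite big_cons msymMm symt.
Qed.

Lemma msym_var s (j : 'I_n) : msym s 'X_j = 'X_(s j) :> {mpoly int[n]}.
Proof.
rewrite msymX; congr 'X_[_]; apply/mnmP => k; rewrite mnmE !mnm1E.
by rewrite -(inj_eq (@perm_inj _ s)) permKV.
Qed.

(* x^rho prod_j (1 + x_j)^(j-1), whose alternant is the denominator of the
   bialternant formula for Grothendieck polynomials. *)
Definition rho_poly : {mpoly int[n]} :=
  \prod_(j < n) ('X_j ^+ (n.-1 - j) * (1 + 'X_j) ^+ j).

Lemma msym_rho_poly s :
  msym s rho_poly = \prod_(j < n) ('X_(s j) ^+ (n.-1 - j) * (1 + 'X_(s j)) ^+ j).
Proof.
rewrite /rho_poly rmorph_prod /=; apply: eq_bigr => j _.
by rewrite rmorphM !rmorphXn rmorphD rmorph1 /= msym_var.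
Qed.

(** The exponents at [lo i] and [hi i] differ by one, so everything except one factor [X_lo] and one
    factor [1 + X_hi] is symmetric in these two variables. *)
Lemma rho_poly_adjacent i : exists2 h,
  rho_poly = h * ('X_(lo i) * (1 + 'X_(hi i))) &
  msym (tperm (lo i) (hi i)) h = h.
Proof.
pose g j : {mpoly int[n]} := 'X_j ^+ (n.-1 - j) * (1 + 'X_j) ^+ j.
pose r : {mpoly int[n]} := \prod_(j < n | (j != lo i) && (j != hi i)) g j.
have symr : msym (tperm (lo i) (hi i)) r = r.
  rewrite rmorph_prod /=; apply: eq_bigr => j /andP[jlo jhi].
  rewrite rmorphM !rmorphXn rmorphD rmorph1 /= msym_var.
  by rewrite tpermD // eq_sym.
exists ('X_(lo i) ^+ (n.-2 - i) * 'X_(hi i) ^+ (n.-2 - i)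
          * ((1 + 'X_(lo i)) ^+ i * (1 + 'X_(hi i)) ^+ i) * r).
  rewrite /rho_poly (bigD1 (lo i)) //= (bigD1 (hi i)) /=; last first.
    by rewrite eq_sym lo_neq_hi.
  rewrite -/r (_ : n.-1 - i = (n.-2 - i).+1)%N; last first.
    by have := ltn_ord i; lia.
  rewrite (_ : n.-1 - i.+1 = n.-2 - i)%N; last lia.
  by rewrite !exprS; ring.
rewrite rmorphM /= symr; congr (_ * _).
rewrite !rmorphM !rmorphXn !rmorphD !rmorph1 /= !msym_var tpermL tpermR.
by congr (_ * _); rewrite mulrC.
Qed.

Lemma alternant_rho_neq0 : alternant rho_poly != 0.
Proof.
rewrite -tofrac_eq0.
pose x k : ratfun n := tofrac ('X_k : {mpoly int[n]}).
have x_neq0 k : x k != 0.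
  rewrite tofrac_eq0; apply/eqP => /(congr1 (mcoeff U_(k))).
  by rewrite mcoeffX eqxx mcoeff0.
pose z : 'rV[ratfun n]_n := \row_k ((1 + x k) / x k).
(* The entry in row [j] and column [k] is [x_k^(n-1-j) (1 + x_k)^j = z_k^j x_k^(n-1)], a Vandermonde
   entry with its column scaled. *)
have -> : tofrac (alternant rho_poly) =
    \det (Vandermonde n z *m diag_mx (\row_k x k ^+ n.-1)).
  rewrite /alternant rmorph_sum /=; apply: eq_bigr => s _.
  rewrite rmorphM rmorphXn rmorphN rmorph1 /=; congr (_ * _).
  rewrite msym_rho_poly rmorph_prod /=; apply: eq_bigr => j _.
  rewrite mul_mx_diag !mxE rmorphM !rmorphXn rmorphD rmorph1 /= -/(x (s j)).
  have -> : x (s j) ^+ n.-1 = x (s j) ^+ (n.-1 - j) * x (s j) ^+ j.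
    by rewrite -exprD subnK //; have := ltn_ord j; lia.
  by rewrite expr_div_n [RHS]mulrCA mulfVK // expf_neq0.
rewrite det_mulmx det_Vandermonde det_diag mulf_neq0 //.
  apply/prodf_neq0 => j _; apply/prodf_neq0 => k lt_jk; rewrite !mxE.
  rewrite subr_eq0; apply/negP => /eqP eqz.
  have : x j = x k.
    have := eqz; rewrite !mulrDl !mul1r !divff // => /addIr /invr_inj.
    by [].
  move/eqP; rewrite tofrac_eq => /eqP eqX.
  have := congr1 (mcoeff U_(j)) eqX; rewrite !mcoeffX eqxx.
  case: eqP => // /mnmP/(_ k); rewrite !mnm1E eqxx; case: eqP => // jk.
  by rewrite jk ltnn in lt_jk.
by apply/prodf_neq0 => j _; rewrite mxE expf_neq0.
Qed.

End Alternants.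

Section Monomials.
Variable n : nat.
Implicit Types (a : 'rV[int]_n).

(* Only meaningful for weights with nonnegative entries. *)
Definition wt_mnm a : 'X_{1..n} := [multinom absz (a 0%R j) | j < n].

Definition xmon a : {mpoly int[n]} := 'X_[wt_mnm a].

Lemma xpow_xmon a : (forall j, 0 <= a 0 j) -> xpow a = tofrac (xmon a).
Proof.
move=> a_ge0; rewrite /xmon mpolyXE_id rmorph_prod; apply: eq_bigr => j _.
by rewrite rmorphXn /= mnmE -{1}(gez0_abs (a_ge0 j)).
Qed.

End Monomials.

(** * Symmetry of string sums and the character formula *)

Section CharacterFormula.
Variables (n : nat) (B : precrystal n).
Hypotheses (regB : regular B) (wt_ge0 : forall (b : B) j, 0 <= wt b 0 j).
Implicit Types (i : 'I_n.-1) (b c : B).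

Lemma msym_reflect i d b : (d.*2 <= eps i b)%N ->
  msym (tperm (lo i) (hi i)) (xmon (wt b) * 'X_(lo i) ^+ d)
    = xmon (wt (string_reflect i d b)) * 'X_(lo i) ^+ d.
Proof.
move=> le_d; rewrite mpolyXn -!mpolyXD msymX tpermV; congr 'X_[_].
apply/mnmP => j; have := wt_string_reflect regB j le_d.
rewrite !(mnmE, mnmDE, mulmnE, mnm1E) ![lo i == _]eq_sym.
have := wt_ge0 b (tperm (lo i) (hi i) j).
have := wt_ge0 (string_reflect i d b) j.
move: (wt _ 0 _) (wt _ 0 _) (_ * d)%N (_ * d)%N => x y z t; lia.
Qed.

(** Reflection is an involution of [Q] that realises the exchange of variables on monomials. The
    case [d = 0] gives the symmetry of characters, and [d = 1] serves truncated strings. *)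
Lemma msym_reflect_sum i d (Q : pred B) :
  (forall b, Q b -> (d.*2 <= eps i b)%N && Q (string_reflect i d b)) ->
  msym (tperm (lo i) (hi i)) (\sum_(b | Q b) xmon (wt b) * 'X_(lo i) ^+ d)
    = \sum_(b | Q b) xmon (wt b) * 'X_(lo i) ^+ d.
Proof.
move=> Qr; rewrite raddf_sum /=.
rewrite [RHS](reindex_onto (string_reflect i d) (string_reflect i d)) /=; last first.
  by move=> b /Qr/andP[le_d _]; apply: string_reflectK.
rewrite big_mkcond [RHS]big_mkcond; apply: eq_bigr => b _.
case: ifP => [Qb|nQb].
  have /andP[le_d ->] := Qr b Qb.
  by rewrite string_reflectK // eqxx msym_reflect.
case: ifP => // /andP[/Qr/andP[_ Qrr] /eqP rK].
by rewrite rK nQb in Qrr.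
Qed.

(** Strings have even length, so an odd position is always followed by an even one, and its monomial
    is that of the even position times [X_lo]. Hence the sum over [Q] is the sum over even positions
    times [1 + X_lo]. Together with the factor [X_lo], the even positions are symmetric by
    reflection with [d = 1], and [(1 + X_lo) (1 + X_hi)] is symmetric too. *)
Lemma msym_bad_sum i (Q : pred B) :
  (forall b, Q b -> (0 < eps i b)%N) ->
  (forall b c, f i b = Some c -> Q b -> Q c) ->
  (forall b c, e i b = Some c -> (0 < eps i c)%N -> Q b -> Q c) ->
  let p := \sum_(b | Q b) xmon (wt b) * ('X_(lo i) * (1 + 'X_(hi i))) in
  msym (tperm (lo i) (hi i)) p = p.
Proof.
move=> Qeps Qf Qe p.
pose Q2 := [pred b | Q b & ~~ odd (eps i b)].
have Q2eps b : Q2 b -> (2 <= eps i b)%N by move=> /andP[/Qeps]; lia.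
have oddE : \sum_(b | Q b && odd (eps i b)) xmon (wt b)
    = \sum_(b | Q2 b) xmon (wt b) * 'X_(lo i).
  (* [e i] matches the even positions with the odd ones just above them; on the elements that are
     summed the defaults are not reached. *)
  rewrite (reindex_onto (fun b => odflt b (e i b)) (fun c => odflt c (f i c))) /=.
    have Q2E b : Q (odflt b (e i b)) && odd (eps i (odflt b (e i b)))
        && (odflt (odflt b (e i b)) (f i (odflt b (e i b))) == b) = Q2 b.
      case eb: (e i b) => [c|] /=.
        have /(e_f regB) fc := eb; rewrite fc /= eqxx andbT.
        have epsb := eps_e regB eb; rewrite epsb /= negbK.
        case oc: (odd (eps i c)); rewrite ?andbF ?andbT //.
        apply/idP/idP => [|Qb]; first exact: Qf.
        by apply: Qe eb _ Qb; case: (eps i c) oc.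
      move/eqP: eb; rewrite -(eps_eq0 regB) => /eqP eps0.
      by rewrite eps0 andbF /=; apply/esym/negP => /andP[/Qeps]; rewrite eps0.
    rewrite (eq_bigl _ _ Q2E); apply: eq_bigr => b Q2b.
    have [c eb] := eps_gt0 regB (ltnW (Q2eps b Q2b)).
    rewrite eb /= -mpolyXD; congr 'X_[_]; apply/mnmP => j.
    rewrite mnmDE !mnmE (wt_e regB eb); case/andP: Q2b => _ /negPf->.
    have := wt_ge0 b j; rewrite !mxE eqxx /= [lo i == j]eq_sym.
    by move: (wt b 0 j) => x; lia.
  move=> b /andP[Qb ob]; have [|c fb] := phi_gt0 regB (i := i) (b := b).
    by have := odd_eps_phi regB i b; lia.
  by rewrite fb /=; have /(e_f regB)-> := fb.
have -> : p = (\sum_(b | Q2 b) xmon (wt b) * 'X_(lo i) ^+ 1)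
                * ((1 + 'X_(lo i)) * (1 + 'X_(hi i))).
  rewrite /p -mulr_suml (bigID (fun b => odd (eps i b))) /= oddE -!mulr_suml.
  by ring.
rewrite rmorphM /= msym_reflect_sum; last first.
  move=> b Q2b; have le2 := Q2eps b Q2b; rewrite le2 /=.
  have [top_r eps_r phi_r] := string_reflectP regB (d := 1) le2.
  have := Q2b => /andP[Qb ob]; apply/andP; split; last first.
    by rewrite eps_r oddD -(odd_eps_phi regB) (negPf ob).
  by apply: (string_closed regB Qf Qe (esym top_r)) Qb; rewrite eps_r; lia.
rewrite rmorphM !rmorphD rmorph1 /= !msym_var tpermL tpermR.
by rewrite [(1 + 'X_(lo i)) * _]mulrC.
Qed.

Variables (Y : pred B) (bad : B -> option 'I_n.-1).
Hypotheses (Y_e : forall i b c, e i b = Some c -> Y b -> Y c)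
           (Y_f : forall i b c, f i b = Some c -> Y b -> Y c).
Hypotheses (bad_HW : forall b, (bad b == None) = (b \in HW B))
           (bad_eps : forall i b, bad b = Some i -> (0 < eps i b)%N)
           (bad_f : forall i b c,
              bad b = Some i -> f i b = Some c -> bad c = Some i)
           (bad_e : forall i b c, bad b = Some i -> e i b = Some c ->
              (0 < eps i c)%N -> bad c = Some i).

Lemma character_formula :
  (\sum_(b | Y b) xmon (wt b)) * alternant (rho_poly n)
    = \sum_(b | Y b && (b \in HW B)) alternant (xmon (wt b) * rho_poly n).
Proof.
(* The character is symmetric because [Y] is a union of whole strings, so it can be moved inside the
   alternant. *)
rewrite -alternant_sym; last first.
  apply: msym_adjacent => i.
  have := @msym_reflect_sum i 0 Y; rewrite -mulr_suml expr0 mulr1; apply.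
  move=> b Yb; have [//|top_r _ _] := @string_reflectP _ _ regB i 0 b.
  apply: (@string_closed _ _ regB i Y 0) (esym top_r) _ Yb => // [b1 c1 fb1|b1 c1 eb1 _].
    exact: Y_f fb1.
  exact: Y_e eb1.
(* Split by bad index: [None] collects the highest weight elements, and each class [Some i]
   contributes zero. *)
rewrite mulr_suml alternant_sum (partition_big bad predT) //=.
rewrite (bigD1 None) //= addrC big1 => [|[i _|//]].
  by rewrite add0r; apply: eq_bigl => b; rewrite bad_HW.
rewrite -alternant_sum; apply: (alternant_tperm (lo_neq_hi i)).
have [h -> symh] := rho_poly_adjacent i.
pose Q := [pred b | Y b & bad b == Some i].
have := @msym_bad_sum i Q; rewrite -!mulr_suml => symQ.
rewrite mulrCA rmorphM /= symh symQ //.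
- by move=> b /andP[_ /eqP/bad_eps].
- move=> b c fb /andP[Yb /eqP badb]; rewrite /= (Y_f fb Yb).
  by rewrite (bad_f badb fb) eqxx.
move=> b c eb gt0 /andP[Yb /eqP badb]; rewrite /= (Y_e eb Yb).
by rewrite (bad_e badb eb gt0) eqxx.
Qed.

End CharacterFormula.

Lemma SS_power_character n m (Y : pred (SS_power n m)) :
  (forall i b c, e i b = Some c -> Y b -> Y c) ->
  (forall i b c, f i b = Some c -> Y b -> Y c) ->
  (\sum_(b | Y b) xmon (wt b)) * alternant (rho_poly n)
    = \sum_(b | Y b && (b \in HW _)) alternant (xmon (wt b) * rho_poly n).
Proof.
move=> Y_e Y_f; have regm := @regular_SS_power n m.
apply: (@character_formula n _ regm (@SS_power_wt_ge0 n m) Y (@bad_index n m)) => //.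
- exact: bad_index_HW.
- by move=> i b /bad_index_e[c /(eps_e regm)->].
- by move=> i b c; apply: bad_index_f.
by move=> i b c; apply: bad_index_ee.
Qed.

(** * Set-valued tableaux *)

Section Words.
Variables (n : nat) (D : eqType).
Implicit Types (T : D -> SS n) (r : seq D) (i : 'I_n.-1) (u v : D).

(** Entries lie in [SS n], so they are nonempty by their type; the list of boxes is kept apart from
    the filling so that it can be split at a box. *)
Fixpoint word T r : SS_power n (size r) :=
  if r is u :: r' then (T u, word T r') else tt.

Lemma eq_in_word T T' r : {in r, T =1 T'} -> word T r = word T' r.
Proof.
elim: r => //= u r IHr eqT; rewrite eqT ?mem_head // IHr // => v rv.
by rewrite eqT // inE rv orbT.
Qed.

Lemma word_inj T T' r : word T r = word T' r -> {in r, T =1 T'}.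
Proof.
elim: r => //= u r IHr [Tu /IHr Tr] v; rewrite inE => /predU1P[->//|].
exact: Tr.
Qed.

Lemma wt_word T r : wt (word T r) = \sum_(u <- r) wt (T u).
Proof. by elim: r => [|u r IHr]; rewrite ?big_nil ?big_cons //= -IHr. Qed.

Lemma eps_word_cons i T u r : eps i (word T (u :: r)) =
  (eps i (word T r) + (eps i (T u) - phi i (word T r)))%N.
Proof. exact: (eps_tensor (@regular_SS n) (@regular_SS_power n _)). Qed.

Lemma phi_word_cons i T u r : phi i (word T (u :: r)) =
  (phi i (T u) + (phi i (word T r) - eps i (T u)))%N.
Proof. exact: (phi_tensor (@regular_SS n) (@regular_SS_power n _)). Qed.

Lemma eps_word_nil i T : eps i (word T [::]) = 0%N.
Proof. by rewrite /eps string_length0. Qed.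

Lemma phi_word_nil i T : phi i (word T [::]) = 0%N.
Proof. by rewrite /phi string_length0. Qed.

Lemma phi_word_cat i T r1 r2 : phi i (word T (r1 ++ r2)) =
  (phi i (word T r1) + (phi i (word T r2) - eps i (word T r1)))%N.
Proof.
elim: r1 => [|u r1 IHr]; first by rewrite phi_word_nil eps_word_nil subn0.
rewrite cat_cons !phi_word_cons IHr eps_word_cons; lia.
Qed.

Lemma eps_word_cat i T r1 r2 : eps i (word T (r1 ++ r2)) =
  (eps i (word T r2) + (eps i (word T r1) - phi i (word T r2)))%N.
Proof.
elim: r1 => [|u r1 IHr]; first by rewrite eps_word_nil addn0.
rewrite cat_cons !eps_word_cons IHr phi_word_cat; lia.
Qed.

Lemma phi_word0 i T r :
  (forall u, u \in r -> lo i \notin val (T u)) -> phi i (word T r) = 0%N.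
Proof.
elim: r => [|u r IHr] Tr; first exact: phi_word_nil.
rewrite phi_word_cons IHr; last by move=> v rv; apply: Tr; rewrite inE rv orbT.
by rewrite SS_phiE (negPf (Tr u (mem_head _ _))).
Qed.

Lemma eps_word0 i T r :
  (forall u, u \in r -> hi i \notin val (T u)) -> eps i (word T r) = 0%N.
Proof.
elim: r => [|u r IHr] Tr; first exact: eps_word_nil.
rewrite eps_word_cons IHr; last by move=> v rv; apply: Tr; rewrite inE rv orbT.
by rewrite SS_epsE (negPf (Tr u (mem_head _ _))).
Qed.

(** Only entries read later and containing [lo i] can cancel the [eps] of [u]. Dually, in
    [phi_word_ge] only earlier entries containing [hi i] can cancel its [phi]. *)
Lemma eps_word_ge i T r1 u r2 :
  (forall v, v \in r2 -> lo i \notin val (T v)) ->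
  (eps i (T u) <= eps i (word T (r1 ++ u :: r2)))%N.
Proof.
by move=> /phi_word0 phi0; rewrite eps_word_cat eps_word_cons phi0; lia.
Qed.

Lemma phi_word_ge i T r1 u r2 :
  (forall v, v \in r1 -> hi i \notin val (T v)) ->
  (phi i (T u) <= phi i (word T (r1 ++ u :: r2)))%N.
Proof.
by move=> /eps_word0 eps0; rewrite phi_word_cat phi_word_cons eps0; lia.
Qed.

(** A single entry changes because boxes are not repeated in [r]. The two inequalities record what
    the signature rule says about prefix and suffix, as needed in [svt_e]. *)
Lemma e_word i T r y : uniq r -> e i (word T r) = Some y ->
  exists r1 u r2 S,
    [/\ r = r1 ++ u :: r2, e i (T u) = Some S,
        y = word (fun v => if v == u then S else T v) r,
        (eps i (word T r1) <= phi i (T u))%N &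
        (phi i (word T r2) < eps i (T u))%N].
Proof.
elim: r y => [|v r IHr] // y /andP[vr uniq_r]; rewrite [LHS]SS_power_eE.
case: leqP => le_v; last first.
  case eS: (e i (T v)) => [S|] //= [<-]; exists [::], v, r, S; split=> //.
    rewrite eqxx; congr (_, _); apply: eq_in_word => w rw.
    by case: eqP => // wv; rewrite -wv rw in vr.
  by rewrite eps_word_nil.
case ew: (e i (word T r)) => [y'|] //= [<-].
have [r1 [u [r2 [S [rE eS y'E eps1 phi2]]]]] := IHr _ uniq_r ew.
exists (v :: r1), u, r2, S; split=> //; first by rewrite rE.
  rewrite y'E; congr (_, _); case: eqP => // vu.
  by rewrite vu rE mem_cat mem_head orbT in vr.
move: le_v; rewrite rE eps_word_cons phi_word_cat phi_word_cons; lia.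
Qed.

Lemma f_word i T r y : uniq r -> f i (word T r) = Some y ->
  exists r1 u r2 S,
    [/\ r = r1 ++ u :: r2, f i (T u) = Some S,
        y = word (fun v => if v == u then S else T v) r,
        (eps i (word T r1) < phi i (T u))%N &
        (phi i (word T r2) <= eps i (T u))%N].
Proof.
elim: r y => [|v r IHr] // y /andP[vr uniq_r]; rewrite [LHS]SS_power_fE.
case: ltnP => le_v; last first.
  case fS: (f i (T v)) => [S|] //= [<-]; exists [::], v, r, S; split=> //.
    rewrite eqxx; congr (_, _); apply: eq_in_word => w rw.
    by case: eqP => // wv; rewrite -wv rw in vr.
  by rewrite eps_word_nil (phi_f (@regular_SS n) fS).
case fw: (f i (word T r)) => [y'|] //= [<-].
have [r1 [u [r2 [S [rE fS y'E eps1 phi2]]]]] := IHr _ uniq_r fw.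
exists (v :: r1), u, r2, S; split=> //; first by rewrite rE.
  rewrite y'E; congr (_, _); case: eqP => // vu.
  by rewrite vu rE mem_cat mem_head orbT in vr.
move: le_v; rewrite rE eps_word_cons phi_word_cat phi_word_cons; lia.
Qed.

(** Every suffix of a highest weight word is again of highest weight, so [HW_tensor] applies at
    [u]. *)
Lemma HW_word T r1 u r2 i :
  word T (r1 ++ u :: r2) \in HW _ -> (eps i (T u) <= phi i (word T r2))%N.
Proof.
have reg1 := @regular_SS n.
elim: r1 => [|v r1 IHr] /=.
  by move=> /(HW_tensor (_, _) reg1 (@regular_SS_power n _))[_].
by move=> /(HW_tensor (_, _) reg1 (@regular_SS_power n _))[/IHr].
Qed.

End Words.

(** * Reading words of set-valued tableaux *)

Section Tableaux.
Variables (n : nat) (lam : 'I_n -> nat).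
Hypothesis lam_noninc : forall i j : 'I_n, (i <= j)%N -> (lam j <= lam i)%N.
Local Notation D := (box lam).
Implicit Types (u v w z : D) (T : D -> SS n) (i : 'I_n.-1).

Lemma box_inj u v : box_row u = box_row v -> box_col u = box_col v -> u = v.
Proof.
case: u v => [r c] [r' c']; rewrite /box_row /box_col /= => /val_inj rr.
by case: r' / rr c' => c' /val_inj->.
Qed.

(** This supplies the corner boxes through which entries in different rows and columns are compared;
    it rests on the monotonicity of [lam]. *)
Lemma box_exists z r c : (r <= box_row z)%N -> (c <= box_col z)%N ->
  exists u, box_row u = r /\ box_col u = c.
Proof.
case: z => [r' c']; rewrite /box_row /box_col /= => le_r le_c.
have lt_rn : (r < n)%N := leq_ltn_trans le_r (ltn_ord r').
have lt_c : (c < lam (Ordinal lt_rn))%N.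
  apply: leq_ltn_trans le_c (leq_trans (ltn_ord c') _); exact: lam_noninc.
by exists (Tagged (fun k : 'I_n => 'I_(lam k)) (Ordinal lt_c)).
Qed.

Definition reads_before u v : bool :=
  (box_col u < box_col v)%N
  || ((box_col u == box_col v) && (box_row v < box_row u)%N).

(* Columns from left to right, each one from bottom to top. *)
Definition reading : seq D :=
  sort (fun u v => (u == v) || reads_before u v) (enum D).

Lemma mem_reading u : u \in reading.
Proof. by rewrite mem_sort mem_enum. Qed.

Lemma uniq_reading : uniq reading.
Proof. by rewrite sort_uniq enum_uniq. Qed.

Lemma reading_split r1 u r2 : reading = r1 ++ u :: r2 ->
  (forall v, v \in r1 -> reads_before v u) /\
  (forall v, v \in r2 -> reads_before u v).
Proof.
move=> rdE.
have : pairwise (fun u v => (u == v) || reads_before u v) reading.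
  rewrite -sorted_pairwise; first apply: sort_sorted.
    move=> v w; case: eqVneq => //= nvw; rewrite /reads_before.
    have := @box_inj v w; case: (ltngtP (box_col v)) => //= cc.
    case: ltngtP => //= rr /(_ (esym rr) cc) vw; by rewrite vw eqxx in nvw.
  move=> v w z /predU1P[->//|vw] /predU1P[<-|]; first by rewrite vw orbT.
  by move: vw; rewrite /reads_before => vw wz; apply/orP; right; lia.
have := uniq_reading; rewrite rdE cat_uniq pairwise_cat /=.
case/and3P=> _ /norP[nu _] /andP[ur2 _].
case/and3P=> /allrelP rel1 _ /andP[/allP rel2 _].
split=> v rv.
  have := rel1 v u rv (mem_head _ _); case: eqP => // vu.
  by rewrite -vu rv in nu.
by have := rel2 v rv; case: eqP => // vu; rewrite vu rv in ur2.
Qed.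

Definition svt T : Prop :=
  (forall u v, box_row u = box_row v -> (box_col u < box_col v)%N ->
     forall a b, a \in val (T u) -> b \in val (T v) -> (a <= b)%N) /\
  (forall u v, box_col u = box_col v -> (box_row u < box_row v)%N ->
     forall a b, a \in val (T u) -> b \in val (T v) -> (a < b)%N).

Lemma SS_nonempty (S : SS n) : exists a, a \in val S.
Proof. by case: S => S S0; apply/set0Pn. Qed.

(** Conditions on all choices reduce to pairs of entries, since a choice prescribed in two boxes
    extends to the other boxes, which are nonempty. *)
Lemma svtP T : reflect (svt T)
  (set_valued_semistandard [ffun u => val (T u)]).
Proof.
apply: (iffP andP) => [[_ /forallP semi]|[rowT colT]].
  have semi2 u v a b : u != v -> a \in val (T u) -> b \in val (T v) ->
      exists2 t : {ffun D -> 'I_n}, semistandard t & t u = a /\ t v = b.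
    move=> uv aT bT.
    have /fin_all_exists[t0 t0T] : forall w, exists c, c \in val (T w).
      by move=> w; apply: SS_nonempty.
    pose t := [ffun w => if w == u then a else if w == v then b else t0 w].
    exists t; last by rewrite !ffunE eqxx eq_sym (negPf uv) eqxx.
    apply: (implyP (semi t)); apply/forallP => w; rewrite !ffunE.
    by case: eqP => [->//|_]; case: eqP => [->|].
  split=> u v eq_uv lt_uv a b aT bT.
    have uv : u != v by apply: contraTneq lt_uv => ->; rewrite ltnn.
    have [t /forallP/(_ u)/forallP/(_ v)/andP[st _] [tu tv]] := semi2 _ _ _ _ uv aT bT.
    by move: st; rewrite eq_uv eqxx lt_uv tu tv.
  have uv : u != v by apply: contraTneq lt_uv => ->; rewrite ltnn.
  have [t /forallP/(_ u)/forallP/(_ v)/andP[_ st] [tu tv]] := semi2 _ _ _ _ uv aT bT.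
  by move: st; rewrite eq_uv eqxx lt_uv tu tv.
split.
  by apply/forallP => u; rewrite ffunE; apply/set0Pn; apply: SS_nonempty.
apply/forallP => t; apply/implyP => /forallP tT.
have {}tT w : t w \in val (T w) by have := tT w; rewrite ffunE.
apply/forallP => u; apply/forallP => v; apply/andP; split; apply/implyP.
  by case/andP => /eqP eq_uv lt_uv; apply: rowT eq_uv lt_uv _ _ _ _.
by case/andP => /eqP eq_uv lt_uv; apply: colT eq_uv lt_uv _ _ _ _.
Qed.

Lemma svt_remove T u (S : SS n) :
  svt T -> val S \subset val (T u) -> svt (fun v => if v == u then S else T v).
Proof.
move=> [rowT colT] /subsetP sub.
have subT v a : a \in val (if v == u then S else T v) -> a \in val (T v).
  by case: eqP => [->|//]; apply: sub.
by split=> v w eq_vw lt_vw a b /subT aT /subT bT;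
  [apply: rowT aT bT | apply: colT aT bT].
Qed.

Lemma svt_add T u (S : SS n) (x : 'I_n) :
  svt T -> val S = x |: val (T u) ->
  (forall v b, b \in val (T v) ->
     [/\ box_row u = box_row v -> (box_col u < box_col v)%N -> (x <= b)%N,
         box_row u = box_row v -> (box_col v < box_col u)%N -> (b <= x)%N,
         box_col u = box_col v -> (box_row u < box_row v)%N -> (x < b)%N &
         box_col u = box_col v -> (box_row v < box_row u)%N -> (b < x)%N]) ->
  svt (fun v => if v == u then S else T v).
Proof.
move=> [rowT colT] SE xT; split=> v w eq_vw lt_vw a b.
  case: eqP => [vu|_]; case: eqP => [wu|_].
  - by rewrite vu wu ltnn in lt_vw.
  - rewrite vu in eq_vw lt_vw; rewrite SE inE => /orP[/set1P->|aT] bT.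
      by have [H _ _ _] := xT w b bT; apply: H.
    exact: rowT aT bT.
  - rewrite wu in eq_vw lt_vw; rewrite SE inE => aT /orP[/set1P->|bT].
      by have [_ H _ _] := xT v a aT; apply: H.
    exact: rowT aT bT.
  - exact: rowT.
case: eqP => [vu|_]; case: eqP => [wu|_].
- by rewrite vu wu ltnn in lt_vw.
- rewrite vu in eq_vw lt_vw; rewrite SE inE => /orP[/set1P->|aT] bT.
    by have [_ _ H _] := xT w b bT; apply: H.
  exact: colT aT bT.
- rewrite wu in eq_vw lt_vw; rewrite SE inE => aT /orP[/set1P->|bT].
    by have [_ _ _ H] := xT v a aT; apply: H.
  exact: colT aT bT.
- exact: colT.
Qed.

Lemma mem_lo i (S : {set 'I_n}) (a : 'I_n) : a \in S -> a = i :> nat -> lo i \in S.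
Proof. by move=> aS ai; rewrite (_ : lo i = a) //; apply: val_inj. Qed.

Lemma mem_hi i (S : {set 'I_n}) (a : 'I_n) : a \in S -> a = i.+1 :> nat -> hi i \in S.
Proof. by move=> aS ai; rewrite (_ : hi i = a) //; apply: val_inj. Qed.

Lemma eps_prefix i T r1 u r2 v :
  reading = r1 ++ u :: r2 -> reads_before v u ->
  (forall z, reads_before v z -> reads_before z u -> lo i \notin val (T z)) ->
  (eps i (T v) <= eps i (word T r1))%N.
Proof.
move=> rdE vu noT; have [rd1 rd2] := reading_split rdE.
have : v \in r1.
  have := mem_reading v; rewrite rdE mem_cat inE => /or3P[//|/eqP v_u|/rd2];
    move: vu; rewrite ?v_u /reads_before; lia.
move=> /path.splitPr r1E; case: r1E rdE rd1 => p1 p2 rdE rd1.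
apply: eps_word_ge => z p2z.
have [|_ rdv] := @reading_split p1 v (p2 ++ u :: r2); first by rewrite rdE -catA.
apply: noT; first by apply: rdv; rewrite mem_cat p2z.
by apply: rd1; rewrite mem_cat inE p2z !orbT.
Qed.

Lemma phi_suffix i T r1 u r2 v :
  reading = r1 ++ u :: r2 -> reads_before u v ->
  (forall z, reads_before u z -> reads_before z v -> hi i \notin val (T z)) ->
  (phi i (T v) <= phi i (word T r2))%N.
Proof.
move=> rdE uv noT; have [rd1 rd2] := reading_split rdE.
have : v \in r2.
  have := mem_reading v; rewrite rdE mem_cat inE => /or3P[/rd1|/eqP v_u|//];
    move: uv; rewrite ?v_u /reads_before; lia.
move=> /path.splitPr r2E; case: r2E rdE rd2 => p1 p2 rdE rd2.
apply: phi_word_ge => z p1z.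
have [|rdv _] := @reading_split (r1 ++ u :: p1) v p2; first by rewrite rdE -catA.
apply: noT; first by apply: rd2; rewrite mem_cat p1z.
by apply: rdv; rewrite mem_cat inE p1z !orbT.
Qed.

(** Removing [hi i] is harmless. Inserting [lo i] could only clash with a [lo i] above [u] in its
    column or with a [hi i] to its left in its row, and the two inequalities exclude both. *)
Lemma svt_e i T r1 u r2 (S : SS n) : svt T -> reading = r1 ++ u :: r2 ->
  e i (T u) = Some S -> (eps i (word T r1) <= phi i (T u))%N ->
  (phi i (word T r2) < eps i (T u))%N ->
  svt (fun v => if v == u then S else T v).
Proof.
move=> svtT rdE /SS_e_Some[hu SE] eps1 phi2; have [rowT colT] := svtT.
move: SE; case: ifP => [lu|nlu] SE.
  by apply: svt_remove => //; rewrite SE subsetDl.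
have phiu : phi i (T u) = 0%N by rewrite SS_phiE nlu.
have epsu : eps i (T u) = 2%N by rewrite SS_epsE hu nlu.
(* Such a [v] is read after [u] with no [hi i] in between, so its [phi], equal to 2, bounds [phi] of
   the suffix from below, against [phi2]. *)
have no_above v : box_col u = box_col v -> (box_row v < box_row u)%N ->
    lo i \notin val (T v).
  move=> cc rr; apply/negP => lv.
  have nhv : hi i \in val (T v) = false.
    by apply/negP => hv; have := colT _ _ (esym cc) rr _ _ hv hu; rewrite ltnn.
  have : (phi i (T v) <= phi i (word T r2))%N.
    apply: (phi_suffix rdE) => [|z uz zv]; first by rewrite /reads_before; lia.
    have [cz rz] : box_col z = box_col u /\ (box_row z < box_row u)%N.
      by move: uz zv; rewrite /reads_before; lia.
    by apply/negP => hz; have := colT z u cz rz _ _ hz hu; rewrite ltnn.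
  by move: phi2; rewrite SS_phiE lv nhv epsu; lia.
(* Such a [v] would give the prefix a positive [eps], unless some [z] read between [v] and [u]
   contained [lo i]. Comparison along rows and columns, through a corner box [y] where necessary,
   rules out every position of [z]. *)
have no_left v : box_row u = box_row v -> (box_col v < box_col u)%N ->
    hi i \notin val (T v).
  move=> rr cc; apply/negP => hv.
  have : (eps i (T v) <= eps i (word T r1))%N.
    apply: (eps_prefix rdE) => [|z vz zu]; first by rewrite /reads_before; lia.
    apply/negP => lz; move: vz zu; rewrite /reads_before => vz zu.
    case: (ltngtP (box_row z) (box_row u)) => rz.
    - have [y [yr yc]] := @box_exists u (box_row z) (box_col u) (ltnW rz) (leqnn _).
      have [a aT] := SS_nonempty (T y).
      have cz : (box_col z < box_col y)%N by lia.
      have lea := rowT z y (esym yr) cz _ _ lz aT.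
      have ry : (box_row y < box_row u)%N by rewrite yr.
      have ltu := colT y u yc ry _ _ aT hu.
      have /negP := no_above y (esym yc) ry; apply.
      by apply: mem_lo aT _; move: lea ltu => /=; lia.
    - have [cz|cz] := eqVneq (box_col z) (box_col u).
        by have := colT u z (esym cz) rz _ _ hu lz; rewrite /= ltnNge leqnSn.
      have [|y [yr yc]] := @box_exists u (box_row u) (box_col z) (leqnn _); first lia.
      have [a aT] := SS_nonempty (T y).
      have ry : (box_row y < box_row z)%N by rewrite yr.
      have cy : (box_col v < box_col y)%N by lia.
      have := rowT v y (etrans (esym rr) (esym yr)) cy _ _ hv aT.
      by have := colT y z yc ry _ _ aT lz; rewrite /=; lia.
    have cz : (box_col v < box_col z)%N by lia.
    by have := rowT v z (etrans (esym rr) (esym rz)) cz _ _ hv lz; rewrite /= ltnn.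
  by move: eps1; rewrite SS_epsE hv phiu; case: ifP; lia.
apply: (svt_add svtT SE) => v b bT; split=> [rr cc|rr cc|cc rr|cc rr] /=.
- by have := rowT u v rr cc _ _ hu bT; rewrite /=; lia.
- have := rowT v u (esym rr) cc _ _ bT hu; rewrite /= leq_eqVlt => /predU1P[bh|//].
  by have := no_left v rr cc; rewrite (mem_hi bT bh).
- by have := colT u v cc rr _ _ hu bT; rewrite /=; lia.
have := colT v u (esym cc) rr _ _ bT hu; rewrite /= ltnS leq_eqVlt => /predU1P[bl|//].
by have := no_above v cc rr; rewrite (mem_lo bT bl).
Qed.

(** Dual to [svt_e]: inserting [hi i] could only clash with a [hi i] below [u] or with a [lo i] to
    its right. *)
Lemma svt_f i T r1 u r2 (S : SS n) : svt T -> reading = r1 ++ u :: r2 ->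
  f i (T u) = Some S -> (eps i (word T r1) < phi i (T u))%N ->
  (phi i (word T r2) <= eps i (T u))%N ->
  svt (fun v => if v == u then S else T v).
Proof.
move=> svtT rdE /SS_f_Some[lu SE] eps1 phi2; have [rowT colT] := svtT.
move: SE; case: ifP => [hu|nhu] SE.
  by apply: svt_remove => //; rewrite SE subsetDl.
have phiu : phi i (T u) = 2%N by rewrite SS_phiE lu nhu.
have epsu : eps i (T u) = 0%N by rewrite SS_epsE nhu.
have no_below v : box_col u = box_col v -> (box_row u < box_row v)%N ->
    hi i \notin val (T v).
  move=> cc rr; apply/negP => hv.
  have nlv : lo i \in val (T v) = false.
    by apply/negP => lv; have := colT _ _ cc rr _ _ lu lv; rewrite ltnn.
  have : (eps i (T v) <= eps i (word T r1))%N.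
    apply: (eps_prefix rdE) => [|z vz zu]; first by rewrite /reads_before; lia.
    have [cz rz] : box_col u = box_col z /\ (box_row u < box_row z)%N.
      by move: vz zu; rewrite /reads_before; lia.
    by apply/negP => lz; have := colT u z cz rz _ _ lu lz; rewrite ltnn.
  by move: eps1; rewrite SS_epsE hv nlv phiu; lia.
have no_right v : box_row u = box_row v -> (box_col u < box_col v)%N ->
    lo i \notin val (T v).
  move=> rr cc; apply/negP => lv.
  have : (phi i (T v) <= phi i (word T r2))%N.
    apply: (phi_suffix rdE) => [|z uz zv]; first by rewrite /reads_before; lia.
    apply/negP => hz; move: uz zv; rewrite /reads_before => uz zv.
    case: (ltngtP (box_row z) (box_row u)) => rz.
    - have [||y [yr yc]] := @box_exists v (box_row u) (box_col z); [lia|lia|].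
      have [a aT] := SS_nonempty (T y).
      have ry : (box_row z < box_row y)%N by rewrite yr.
      have cy : (box_col y < box_col v)%N by lia.
      have := rowT y v (etrans yr rr) cy _ _ aT lv.
      by have := colT z y (esym yc) ry _ _ hz aT; rewrite /=; lia.
    - have [||y [yr yc]] := @box_exists z (box_row z) (box_col u); [lia|lia|].
      have [a aT] := SS_nonempty (T y).
      have cz : (box_col y < box_col z)%N by lia.
      have lea := rowT y z yr cz _ _ aT hz.
      have ry : (box_row u < box_row y)%N by rewrite yr.
      have ltu := colT u y (esym yc) ry _ _ lu aT.
      have /negP := no_below y (esym yc) ry; apply.
      by apply: mem_hi aT _; move: lea ltu => /=; lia.
    have cz : (box_col z < box_col v)%N by lia.
    by have := rowT z v (etrans rz rr) cz _ _ hz lv; rewrite /= ltnn.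
  by move: phi2; rewrite SS_phiE lv epsu; case: ifP; lia.
apply: (svt_add svtT SE) => v b bT; split=> [rr cc|rr cc|cc rr|cc rr] /=.
- have := rowT u v rr cc _ _ lu bT; rewrite /= leq_eqVlt => /predU1P[bl|//].
  by have := no_right v rr cc; rewrite (mem_lo bT (esym bl)).
- by have := rowT v u (esym rr) cc _ _ bT lu; rewrite /=; lia.
- have := colT u v cc rr _ _ lu bT; rewrite /= leq_eqVlt => /predU1P[bh|//].
  by have := no_below v cc rr; rewrite (mem_hi bT (esym bh)).
by have := colT v u (esym cc) rr _ _ bT lu; rewrite /=; lia.
Qed.

Lemma highest_subproof u : [set tag u] != set0.
Proof. by apply/set0Pn; exists (tag u); rewrite inE. Qed.

Definition highest u : SS n := Sub [set tag u] (highest_subproof u).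

Lemma svt_highest : svt highest.
Proof.
split=> u v uv lt_uv a b; rewrite /= !inE => /eqP-> /eqP-> //.
by rewrite -/(box_row u) -/(box_row v) uv.
Qed.

(** Each [hi i] of this filling lies in row [i.+1], and the [lo i] in the box just above it, read
    next, cancels it. *)
Lemma HW_highest : word highest reading \in HW _.
Proof.
apply/HWP => i; case ew: (e i _) => [y|] //.
have [r1 [u [r2 [S [rdE /SS_e_Some[hu _] _ _]]]]] := e_word uniq_reading ew.
have rowu : box_row u = i.+1.
  by move: hu; rewrite /= !inE => /eqP hu; rewrite /box_row -hu.
have [||v [vr vc]] := @box_exists u i (box_col u); [lia|lia|].
have : (phi i (highest v) <= phi i (word highest r2))%N.
  apply: (phi_suffix rdE) => [|z uz zv]; first by rewrite /reads_before; lia.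
  by move: uz zv; rewrite /reads_before; lia.
have lv : lo i \in val (highest v) by rewrite /= inE; apply/eqP/val_inj.
have nhv : hi i \in val (highest v) = false.
  by move: lv; rewrite /= !inE => /eqP <-; rewrite eq_sym (negPf (lo_neq_hi i)).
have nlu : lo i \in val (highest u) = false.
  by move: hu; rewrite /= !inE => /eqP <-; rewrite (negPf (lo_neq_hi i)).
by rewrite SS_phiE lv nhv SS_epsE hu nlu; lia.
Qed.

Lemma HW_svt T : svt T -> word T reading \in HW _ -> T =1 highest.
Proof.
move=> [rowT colT] HWT.
(* Boxes are treated from the end of the reading, so that every box read after [u] is known when [u]
   is reached. *)
suff allT r2 r1 : reading = r1 ++ r2 -> forall u, u \in r2 -> T u = highest u.
  by move=> u; apply: (allT reading [::]) => //; apply: mem_reading.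
elim: r2 r1 => [|u r2 IHr] r1 // rdE v; rewrite inE => /predU1P[->{v}|]; last first.
  by apply: (IHr (rcons r1 u)); rewrite cat_rcons.
have [rd1 rd2] := reading_split rdE.
have later v a : reads_before u v -> a \in val (T v) -> a = tag v.
  move=> uv; have r2v : v \in r2.
    have := mem_reading v; rewrite rdE mem_cat inE => /or3P[/rd1|/eqP v_u|//];
      move: uv; rewrite ?v_u /reads_before; lia.
  rewrite (IHr (rcons r1 u) _ v r2v) ?cat_rcons //= inE.
  by move/eqP.
have Tu a : a \in val (T u) -> a = tag u.
  move=> aT; apply: val_inj; apply/eqP; rewrite eqn_leq; apply/andP; split; last first.
    change (box_row u <= a)%N; case ru: (box_row u) => [|r] //.
    have [||v [vr vc]] := @box_exists u r (box_col u); [lia|lia|].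
    have [b bT] := SS_nonempty (T v).
    have rv : (box_row v < box_row u)%N by rewrite vr ru.
    have bv : b = box_row v :> nat.
      by rewrite (later v b _ bT) // /reads_before; lia.
    by have := colT v u vc rv _ _ bT aT; rewrite bv vr.
  (* If [a] exceeds the row of [u], let [i = a - 1]. Highest weight requires a [lo i] after [u]; it
     lies in row [a - 1], in a column to the right. Then the box [y] of that column in the row of
     [u] holds an entry smaller than [a], to the right of [u]. *)
  rewrite leqNgt; apply/negP => lt_a.
  have lt_an : (a.-1 < n.-1)%N by have := ltn_ord a; move: lt_a => /=; lia.
  pose i := Ordinal lt_an.
  have ha : hi i \in val (T u) by apply: mem_hi aT _; move: lt_a => /=; lia.
  move: HWT; rewrite rdE => /(HW_word i); rewrite phi_word0.
    by rewrite SS_epsE ha; case: ifP.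
  move=> v r2v; apply/negP => lv.
  have uv := rd2 v r2v; have /(congr1 val) /= rv := later v _ uv lv.
  have le_r : (box_row u <= box_row v)%N.
    by rewrite /box_row -rv; move: lt_a => /=; lia.
  have [y [yr yc]] := @box_exists v (box_row u) (box_col v) le_r (leqnn _).
  have uy : (box_col u < box_col y)%N.
    by move: uv; rewrite /reads_before; lia.
  have [b bT] := SS_nonempty (T y).
  have := rowT u y (esym yr) uy _ _ aT bT.
  have -> : b = box_row y :> nat by rewrite (later y b _ bT) // /reads_before uy.
  by rewrite yr leqNgt lt_a.
apply: val_inj; apply/setP => a; rewrite /= inE; apply/idP/eqP => [/Tu//|->].
by have [b bT] := SS_nonempty (T u); rewrite -(Tu b bT).
Qed.

Lemma wt_highest j : wt (word highest reading) 0 j = (lam j)%:Z.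
Proof.
rewrite wt_word (perm_big _ (permEl (perm_sort _ _))) big_enum /= summxE.
under eq_bigr => u _ do rewrite -[X in fun_of_matrix X]/(wt (highest u)) SS_wtE /= inE.
transitivity (\sum_(k : 'I_n) \sum_(l : 'I_(lam k)) (j == k)%:Z).
  by rewrite sig_big_dep.
rewrite (bigD1 j) //= [X in _ + X]big1 ?addr0 => [|k kj]; last first.
  by rewrite big1 // => _ _; rewrite eq_sym (negPf kj).
by rewrite sumr_const card_ord eqxx natz.
Qed.

Hypothesis n_gt0 : (0 < n)%N.

Lemma Grothendieck_words : Grothendieck lam =
  \sum_(T : {ffun D -> SS n} | set_valued_semistandard [ffun u => val (T u)])
     xpow (wt (word T reading)).
Proof.
(* [S0] is the default of [insubd]; on set-valued tableaux, whose entries are nonempty, it is never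
   taken. *)
have S0_neq0 : [set Ordinal n_gt0] != set0.
  by apply/set0Pn; exists (Ordinal n_gt0); rewrite inE.
pose S0 : SS n := Sub [set Ordinal n_gt0] S0_neq0.
rewrite /Grothendieck.
rewrite (reindex_onto (fun T : {ffun D -> SS n} => [ffun u => val (T u)])
   (fun T : {ffun D -> {set 'I_n}} => [ffun u => insubd S0 (T u)])) /=.
  apply: eq_big => [T|T _].
    apply: andb_idr => _; apply/eqP/ffunP => u.
    by rewrite !ffunE; apply: valKd.
  congr xpow; rewrite wt_word (perm_big _ (permEl (perm_sort _ _))) big_enum.
  by apply: eq_bigr => u _; rewrite ffunE.
move=> T /andP[/forallP T_neq0 _]; apply/ffunP => u; rewrite !ffunE.
exact/insubdK/T_neq0.
Qed.

Lemma Grothendieck_alternant :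
  Grothendieck lam * tofrac (alternant (rho_poly n))
    = tofrac (alternant ('X_[[multinom lam j | j < n]] * rho_poly n)).
Proof.
pose P := [pred T : {ffun D -> SS n} |
             set_valued_semistandard [ffun u => val (T u)]].
pose Y := [pred x | x \in [set word (fun_of_fin T) reading | T in P]].
have word_reading_inj : injective (fun T : {ffun D -> SS n} => word T reading).
  by move=> T T' /word_inj eqT; apply/ffunP => u; apply/eqT/mem_reading.
have Y_T T : svt T -> Y (word T reading).
  move=> svtT; apply/imsetP; exists [ffun u => T u].
    have /svtP svtbT := svtT; rewrite inE; congr set_valued_semistandard: svtbT.
    by apply/ffunP => u; rewrite !ffunE.
  by apply: eq_in_word => u _; rewrite ffunE.
have T_Y x : Y x -> exists2 T, svt T & x = word T reading.
  by case/imsetP => T PT ->; exists T => //; apply/svtP.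
have Y_e i x y : e i x = Some y -> Y x -> Y y.
  move=> exy /T_Y[T svtT xE]; rewrite xE in exy.
  have [r1 [u [r2 [S [rdE eS -> eps1 phi2]]]]] := e_word uniq_reading exy.
  exact/Y_T/(svt_e svtT rdE eS).
have Y_f i x y : f i x = Some y -> Y x -> Y y.
  move=> fxy /T_Y[T svtT xE]; rewrite xE in fxy.
  have [r1 [u [r2 [S [rdE fS -> eps1 phi2]]]]] := f_word uniq_reading fxy.
  exact/Y_T/(svt_f svtT rdE fS).
have charY := SS_power_character Y_e Y_f.
(* By [HW_svt], only the reading word of [highest] contributes to the right-hand side. *)
rewrite [RHS](big_pred1 (word highest reading)) in charY; last first => [x|].
  apply/idP/eqP => [/andP[/T_Y[T svtT ->] HWx]|->].
    by apply: eq_in_word => u _; apply: HW_svt.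
  by apply/andP; split; [apply/Y_T/svt_highest | apply: HW_highest].
have -> : [multinom lam j | j < n] = wt_mnm (wt (word highest reading)).
  by apply/mnmP => j; rewrite !mnmE wt_highest.
rewrite -/(xmon _) -charY rmorphM /=; congr (_ * _).
rewrite Grothendieck_words rmorph_sum /= big_imset /=; last first.
  by move=> ? ? _ _ /word_reading_inj.
by apply: eq_bigr => T _; rewrite xpow_xmon // => j; apply: SS_power_wt_ge0.
Qed.

End Tableaux.

(** * Components of normal crystals *)

Lemma HW_morphism n (B C : precrystal n) (g : B -> C) :
  (forall i b, e i (g b) = omap g (e i b)) ->
  forall b, (g b \in HW C) = (b \in HW B).
Proof.
move=> ge b; apply/HWP/HWP => e0 i; last by rewrite ge e0.
by have := e0 i; rewrite ge; case: (e i b).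
Qed.

Section Components.
Variables (n : nat) (B : precrystal n).
Hypothesis efB : forall i (b c : B), e i b = Some c <-> f i c = Some b.
Implicit Types b c : B.

Lemma weakly_connected_f i b0 b c :
  f i b = Some c -> weakly_connected b0 b -> weakly_connected b0 c.
Proof.
move=> fb b0b; apply: connect_trans b0b (connect1 _).
by apply/orP; left; apply/existsP; exists i; rewrite fb.
Qed.

Lemma weakly_connected_e i b0 b c :
  e i b = Some c -> weakly_connected b0 b -> weakly_connected b0 c.
Proof.
move=> /efB fc b0b; apply: connect_trans b0b (connect1 _).
by apply/orP; right; apply/existsP; exists i; rewrite fc.
Qed.

(** Components are stable under [e i], so [insub] never loses a value there. *)
Lemma HW_full_subcrystal b0 (x : full_subcrystal b0) :
  (x \in HW (full_subcrystal b0)) = (val x \in HW B).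
Proof.
apply/HWP/HWP => e0 i; last by rewrite /= e0.
have := e0 i; rewrite /=; case ex: (e i (val x)) => [c|] //=.
by rewrite insubT // (weakly_connected_e ex) //; apply: valP.
Qed.

Lemma sum_full_subcrystal (R : nmodType) b0 (P : pred B) (F : B -> R) :
  \sum_(x : full_subcrystal b0 | P (val x)) F (val x)
    = \sum_(b | weakly_connected b0 b && P b) F b.
Proof.
rewrite [RHS](reindex_omap (val : full_subcrystal b0 -> B) insub) => [|b /andP[b0b _]].
  apply: eq_bigl => x; rewrite valK eqxx andbT.
  by rewrite (valP x : weakly_connected b0 (val x)).
by rewrite insubT.
Qed.

End Components.

Section Normal.
Variables (n : nat) (B : precrystal n).
Hypotheses (n_gt0 : (0 < n)%N) (normB : normal_crystal B).

Lemma normal_e_f i (b c : B) : e i b = Some c <-> f i c = Some b.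
Proof. by case: normB => /(_ i)[_ ef _] _; apply: ef. Qed.

Lemma normal_model (b : B) : exists (m : nat) (y : SS_power n m),
  wt y = wt b /\ (y \in HW _) = (b \in HW B).
Proof.
case: normB => _ /(_ b)[m [c [g [_ gwt ge _]]]].
pose x : full_subcrystal b := Sub b (connect0 _ b).
have efm i (y z : SS_power n m) : e i y = Some z <-> f i z = Some y.
  exact: e_f (@regular_SS_power n m) i y z.
exists m, (val (g x)); split; first exact: (gwt x).
rewrite -(HW_full_subcrystal efm) -(HW_full_subcrystal normal_e_f x).
exact: HW_morphism.
Qed.

(** At a highest weight element [eps] vanishes, so by [phi_sub_eps] twice each difference of
    consecutive weight entries is a [phi], hence nonnegative. *)
Lemma normal_HW_partition (b : B) : b \in HW B -> is_partition (wt b).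
Proof.
have [m [y [<- <-]]] := normal_model b => /HWP HWy.
have regm := @regular_SS_power n m.
split=> [j|j k le_jk]; first exact: SS_power_wt_ge0.
have [d kE] : exists d, (k = j + d :> nat)%N by exists (k - j)%N; rewrite subnKC.
elim: d k {le_jk} kE => [|d IHd] k kE.
  by rewrite (_ : k = j) //; apply: val_inj; rewrite /= kE addn0.
have lt_i : (j + d < n.-1)%N by have := ltn_ord k; rewrite kE; lia.
pose i := Ordinal lt_i.
apply: (@le_trans _ _ (wt y 0 (lo i))); last exact: IHd.
have -> : k = hi i by apply: val_inj; rewrite /= kE addnS.
have := phi_sub_eps regm i y.
have /eqP := HWy i; rewrite -(eps_eq0 regm) => /eqP->.
move: (wt y 0 _) (wt y 0 _) (phi i y) => p q r; lia.
Qed.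

Lemma Grothendieck_HW (b : B) : b \in HW B ->
  Grothendieck (parts (wt b)) * tofrac (alternant (rho_poly n))
    = tofrac (alternant (xmon (wt b) * rho_poly n)).
Proof.
move=> /normal_HW_partition[ge0 noninc]; rewrite Grothendieck_alternant //.
by move=> i j /noninc; rewrite /parts; have := ge0 i; have := ge0 j; lia.
Qed.

(** After multiplication by the nonzero alternant of [rho_poly], this is the character formula for a
    component of a tensor power, transported along the isomorphism. *)
Lemma component_character (b0 : B) :
  \sum_(b | weakly_connected b0 b) xpow (wt b)
    = \sum_(b | weakly_connected b0 b && (b \in HW B)) Grothendieck (parts (wt b)).
Proof.
have J_neq0 : tofrac (alternant (rho_poly n)) != 0 :> ratfun n.
  by rewrite tofrac_eq0 alternant_rho_neq0.
apply: (mulIf J_neq0); rewrite [RHS]mulr_suml.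
under [RHS]eq_bigr => b /andP[_ HWb] do rewrite Grothendieck_HW //.
case: normB => _ /(_ b0)[m [c [g [gbij gwt ge _]]]].
have efm i (y z : SS_power n m) : e i y = Some z <-> f i z = Some y.
  exact: e_f (@regular_SS_power n m) i y z.
transitivity (tofrac (\sum_(y | weakly_connected c y) xmon (wt y))
                * tofrac (alternant (rho_poly n)) : ratfun n).
  congr (_ * _); rewrite rmorph_sum /=.
  under [RHS]eq_bigr => y _ do rewrite -(xpow_xmon (SS_power_wt_ge0 y)).
  under [LHS]eq_bigl => b do rewrite -[weakly_connected b0 b]andbT.
  under [RHS]eq_bigl => y do rewrite -[weakly_connected c y]andbT.
  rewrite -(sum_full_subcrystal b0 predT (fun b => xpow (wt b))).
  rewrite -(sum_full_subcrystal c predT (fun y => xpow (wt y))).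
  rewrite [RHS](reindex g) /=; last exact: onW_bij.
  by apply: eq_bigr => x _; have /= -> := gwt x.
have c_e i y z := @weakly_connected_e n _ efm i c y z.
have c_f i y z := @weakly_connected_f n _ i c y z.
rewrite -rmorphM /= (SS_power_character c_e c_f) rmorph_sum /=.
rewrite -(sum_full_subcrystal c (mem (HW _))
  (fun y => tofrac (alternant (xmon (wt y) * rho_poly n)) : ratfun n)).
rewrite -(sum_full_subcrystal b0 (mem (HW _))
  (fun y => tofrac (alternant (xmon (wt y) * rho_poly n)) : ratfun n)).
rewrite (reindex g) /=; last exact: onW_bij.
apply: eq_big => [x|x _]; last by have /= -> := gwt x.
rewrite -[LHS](HW_full_subcrystal efm (g x)).
rewrite -[RHS](HW_full_subcrystal normal_e_f x).
exact: (HW_morphism ge).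
Qed.

End Normal.

Theorem theorem1p1 (n : nat) (n_gt0 : (0 < n)%N) (B : precrystal n)
    (normB : normal_crystal B) :
  (forall b : B, b \in HW B -> is_partition (wt b)) /\
  ch B = \sum_(b in HW B) Grothendieck (parts (wt b)).
Proof.
split=> [b|]; first exact: normal_HW_partition.
pose adj (b c : B) := edge b c || edge c b.
have adj_sym : connect_sym adj.
  by apply: sym_connect_sym => b c; rewrite /adj orbC.
(* Both sums are split over connected components, each represented by its root. *)
rewrite /ch (partition_big (fingraph.root adj) predT) //=.
rewrite [RHS](partition_big (fingraph.root adj) predT) //=; apply: eq_bigr => r _.
(* A vertex that is not a root represents no component, and both of its sums are empty. *)
have [rootr|nrootr] := eqVneq (fingraph.root adj r) r; last first.
  have no_b b : (fingraph.root adj b == r) = false.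
    by apply: contraNF nrootr => /eqP <-; rewrite root_root.
  by rewrite !big_pred0 // => b; rewrite no_b ?andbF.
have compE b : (fingraph.root adj b == r) = weakly_connected r b.
  by rewrite -{1}rootr eq_sym root_connect.
under eq_bigl => b do rewrite compE.
under [RHS]eq_bigl => b do rewrite compE andbC.
exact: component_character.
Qed.
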